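(* Let $\beta>0$, $\omega>0$ and $\omega_*=\beta^2/4$. The critical point $(u_{\mathrm{cr}},v_{\mathrm{cr}})=(1/2,0)$ of the nonlinear autonomous system $$u'=v,\qquad v'=1-\frac{\beta}{\sqrt{\omega}}\,v-\sqrt{2u}$$ is a stable node for $\omega<\omega_*$, a stable spiral for $\omega>\omega_*$, and a stable inflected node for $\omega=\omega_*$.
   Context: The right-hand side is defined for $(u,v)$ with $u\ge 0$, $v\in\mathbb{R}$, and is $C^\infty$ near $(1/2,0)$; the prime denotes differentiation with respect to $s$. Terminology for a critical point of a planar autonomous system: let $(r(s),\theta(s))$ denote polar coordinates centred at the critical point of a nonconstant trajectory, with $\theta$ chosen continuously. The critical point is a stable node if all nonconstant trajectories starting sufficiently close to it satisfy $r(s)\to 0$ and $\theta(s)$ converges to a finite limit as $s\to\infty$; it is a stable spiral (focus) if all such trajectories satisfy $r(s)\to0$ and $|\theta(s)|\to\infty$ as $s\to\infty$; it is a stable inflected (degenerate, improper) node if it is a stable node and all such trajectories approach the critical point tangentially to one and the same straight line through it. *)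

(* Defs.v *)
From Stdlib Require Import Reals.
From Coquelicot Require Import Coquelicot.
Open Scope R_scope.

(* Autonomous system x' = field1 x y, y' = field2 x y; the right-hand side is
   regarded as defined only at the points satisfying [domain]. *)
Record planar_system : Type := PlanarSystem {
  domain : R -> R -> Prop;
  field1 : R -> R -> R;
  field2 : R -> R -> R
}.

Definition critical_point (S : planar_system) (p : R * R) : Prop :=
  domain S (fst p) (snd p) /\
  field1 S (fst p) (snd p) = 0 /\ field2 S (fst p) (snd p) = 0.

Definition time_interval (T : Rbar) (s : R) : Prop := 0 <= s /\ Rbar_lt s T.

(* Solutions on [0, T), 0 < T <= +oo. At the left endpoint only continuity is
   required; for a continuous right-hand side the one-sided differential
   equation at s = 0 then follows. Values outside [0, T) are irrelevant. *)
Definition solution (S : planar_system) (T : Rbar) (x y : R -> R) : Prop :=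
  Rbar_lt 0 T /\
  (forall s, time_interval T s -> domain S (x s) (y s)) /\
  continuous_on (time_interval T) x /\
  continuous_on (time_interval T) y /\
  (forall s, 0 < s -> Rbar_lt s T ->
     is_derive x s (field1 S (x s) (y s)) /\
     is_derive y s (field2 S (x s) (y s))).

(* Trajectories are solutions that cannot be continued beyond T, so that
   existence for all s >= 0 is something to be established, not assumed. *)
Definition trajectory (S : planar_system) (T : Rbar) (x y : R -> R) : Prop :=
  solution S T x y /\
  ~ (exists (T1 : Rbar) (x1 y1 : R -> R),
       Rbar_lt T T1 /\ solution S T1 x1 y1 /\
       (forall s, time_interval T s -> x1 s = x s /\ y1 s = y s)).

Definition nonconstant (T : Rbar) (x y : R -> R) : Prop :=
  exists s, time_interval T s /\ (x s, y s) <> (x 0, y 0).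

(* Since r > 0, a continuous theta is unique up to a constant in 2 PI Z. *)
Definition polar_coordinates (p : R * R) (T : Rbar) (x y r theta : R -> R)
  : Prop :=
  (forall s, time_interval T s ->
     0 < r s /\
     x s = fst p + r s * cos (theta s) /\
     y s = snd p + r s * sin (theta s)) /\
  continuous_on (time_interval T) theta.

Definition nearby_trajectories (S : planar_system) (p : R * R)
    (P : (R -> R) -> (R -> R) -> Prop) : Prop :=
  exists delta : R, 0 < delta /\
    forall (T : Rbar) (x y : R -> R),
      trajectory S T x y -> nonconstant T x y ->
      sqrt ((x 0 - fst p) ^ 2 + (y 0 - snd p) ^ 2) < delta ->
      T = p_infty /\
      exists r theta : R -> R,
        polar_coordinates p T x y r theta /\ P r theta.

Definition stable_node (S : planar_system) (p : R * R) : Prop :=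
  nearby_trajectories S p (fun r theta =>
    is_lim r p_infty 0 /\ exists l : R, is_lim theta p_infty l).

Definition stable_spiral (S : planar_system) (p : R * R) : Prop :=
  nearby_trajectories S p (fun r theta =>
    is_lim r p_infty 0 /\ is_lim (fun s => Rabs (theta s)) p_infty p_infty).

(* The limiting direction (cos l, sin l) is parallel to the line directed by
   (a, b); the trajectory may come in from either side along that line. *)
Definition approaches_tangentially (a b : R) (r theta : R -> R) : Prop :=
  is_lim r p_infty 0 /\
  exists l : R, is_lim theta p_infty l /\ a * sin l = b * cos l.

Definition stable_inflected_node (S : planar_system) (p : R * R) : Prop :=
  stable_node S p /\
  exists a b : R, (a, b) <> (0, 0) /\
    nearby_trajectories S p (approaches_tangentially a b).

Definition sqrt_system (beta omega : R) : planar_system :=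
  PlanarSystem
    (fun u _ => 0 <= u)
    (fun _ v => v)
    (fun u v => 1 - beta / sqrt omega * v - sqrt (2 * u)).

Definition omega_star (beta : R) : R := beta ^ 2 / 4.

(* Main.v *)
Require Import Defs.
From Stdlib Require Import Reals Lra Psatz Classical.
From Coquelicot Require Import Coquelicot.
Open Scope R_scope.

(** Write [k = beta / sqrt omega], [x = u - 1/2], [y = v]. The system becomes
    [x' = y], [y' = - k y - x + g x], where [g = sqrt_remainder] is nonnegative
    and [O(x^2)]. The three cases of the theorem are [k > 2], [k < 2], [k = 2].

    The quadratic form [lyap] decreases exponentially along the flow in a small
    disc. Hence a trajectory that starts close enough stays in the disc; being
    maximal, it is defined for all times, by [solution_extends], which rests on
    the Picard-Lindelof theorem; and it tends to the critical point without
    reaching it. Its polar angle satisfies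
    [theta' = - (1 + k sin theta cos theta) + O(r)].

    For [k < 2] the parenthesis is bounded below by [1 - k/2 > 0], and the angle
    tends to [- oo].

    For [k >= 2] the angle is bounded: [theta' < 0] at the multiples of [2 PI],
    and [theta' > 0] at [- PI/4] modulo [2 PI], where it is the sum of
    [k/2 - 1 >= 0] and of a positive multiple of [g x], with [x > 0]. A direction
    in which [1 + k sin theta cos theta] does not vanish is crossed in one sense
    only once [r] is small, so the angle eventually stays on one side of it. Such
    directions are dense, so the angle converges. This needs neither eigenvector
    coordinates nor a rate of convergence, and treats the degenerate case [k = 2]
    together with [k > 2]. The limit [l] satisfies [1 + k sin l cos l <= 0]; for
    [k = 2] this reads [(sin l + cos l)^2 <= 0], so that all trajectories are
    tangent to the line [y = - x]. *)

(** * Monotonicity, barriers and limits of real functions *)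

(** Replaces, in the goal left by [auto_derive], the derivative of [f] at [t]
    by the value [d] that the hypothesis [H : is_derive f t d] gives it. *)
Ltac derive_rewrite H :=
  match type of H with
  | is_derive ?f ?t ?d =>
      replace (Derive (fun x => f x) t) with d
        by (symmetry; exact (is_derive_unique _ _ _ H))
  end.

Lemma is_derive_continuous (f : R -> R) (t d : R) :
  is_derive f t d -> continuous f t.
Proof.
  intros H; apply (ex_derive_continuous (V := R_NormedModule)); now exists d.
Qed.

Lemma continuous_Rplus (f g : R -> R) (t : R) :
  continuous f t -> continuous g t -> continuous (fun s => f s + g s) t.
Proof. apply (continuous_plus (V := R_NormedModule)). Qed.

Lemma continuous_Rminus (f g : R -> R) (t : R) :
  continuous f t -> continuous g t -> continuous (fun s => f s - g s) t.
Proof. apply (continuous_minus (V := R_NormedModule)). Qed.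

Lemma continuous_Rmult (f g : R -> R) (t : R) :
  continuous f t -> continuous g t -> continuous (fun s => f s * g s) t.
Proof. apply (continuous_mult (K := R_AbsRing)). Qed.

Lemma continuous_pow2 (f : R -> R) (t : R) :
  continuous f t -> continuous (fun s => f s ^ 2) t.
Proof.
  intros Hf; apply (continuous_Rmult f (fun s => f s * 1)); [exact Hf|].
  apply (continuous_Rmult f (fun _ => 1)); [exact Hf | apply continuous_const].
Qed.

Lemma continuous_sum_pow2 (f g : R -> R) (t : R) :
  continuous f t -> continuous g t -> continuous (fun s => f s ^ 2 + g s ^ 2) t.
Proof. intros Hf Hg; apply continuous_Rplus; now apply continuous_pow2. Qed.

Lemma nonincreasing_on (f df : R -> R) (a b : R) :
  a <= b ->
  (forall t, a <= t <= b -> continuous f t) ->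
  (forall t, a < t < b -> is_derive f t (df t) /\ df t <= 0) ->
  f b <= f a.
Proof.
  intros Hab Hc Hd.
  (* The mean value theorem may return an end point, where df is unknown. *)
  set (dg := fun t => if Rlt_dec a t then if Rlt_dec t b then df t else 0 else 0).
  destruct (MVT_gen f a b dg) as [c [_ Hcv]].
  - rewrite Rmin_left, Rmax_right by exact Hab; intros t Ht; unfold dg.
    destruct (Rlt_dec a t); [|lra]; destruct (Rlt_dec t b); [|lra].
    now apply Hd.
  - rewrite Rmin_left, Rmax_right by exact Hab; intros t Ht.
    now apply continuity_pt_filterlim, Hc.
  - assert (dg c <= 0).
    { unfold dg; destruct (Rlt_dec a c); [|lra]; destruct (Rlt_dec c b); [|lra].
      now apply Hd. }
    nra.
Qed.

(** Gronwall's inequality; differentiability is needed in the open interval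
    only, which suits solutions known to be merely continuous at time 0. *)
Lemma gronwall_on (f df : R -> R) (C a b : R) :
  a <= b ->
  (forall t, a <= t <= b -> continuous f t) ->
  (forall t, a < t < b -> is_derive f t (df t) /\ df t <= C * f t) ->
  f b <= f a * exp (C * (b - a)).
Proof.
  intros Hab Hc Hd.
  assert (H : f b * exp (- C * (b - a)) <= f a * exp (- C * (a - a))).
  { apply nonincreasing_on with (f := fun t => f t * exp (- C * (t - a)))
      (df := fun t => (df t - C * f t) * exp (- C * (t - a))); [exact Hab| |].
    - intros t Ht.
      apply (continuous_Rmult f); [now apply Hc|].
      apply (ex_derive_continuous (V := R_NormedModule)); auto_derive; auto.
    - intros t Ht; destruct (Hd t Ht) as [H1 H2]; split.
      + auto_derive; [now exists (df t)|].
        derive_rewrite H1; unfold Rminus; ring.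
      + pose proof (exp_pos (- C * (t - a))); nra. }
  rewrite Rminus_diag, Rmult_0_r, exp_0, Rmult_1_r in H.
  replace (f b) with (f b * exp (- C * (b - a)) * exp (C * (b - a))).
  - apply Rmult_le_compat_r; [apply Rlt_le, exp_pos | exact H].
  - rewrite Rmult_assoc, <- exp_plus.
    replace (- C * (b - a) + C * (b - a)) with 0 by ring.
    rewrite exp_0; ring.
Qed.

Lemma continuous_near (f : R -> R) (t e : R) :
  continuous f t -> 0 < e ->
  exists d, 0 < d /\ forall s, Rabs (s - t) < d -> Rabs (f s - f t) < e.
Proof.
  intros Hf He.
  destruct (proj1 (filterlim_locally _ _) Hf (mkposreal e He)) as [d Hd].
  exists d; split; [apply cond_pos | exact Hd].
Qed.

(** A function that can only cross the level [alpha] downwards, and starts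
    below it, stays below it. *)
Lemma barrier (f : R -> R) (alpha a b : R) :
  a <= b ->
  (forall t, a <= t <= b -> continuous f t) ->
  (forall t, a < t <= b -> f t = alpha ->
     exists d, is_derive f t d /\ d < 0) ->
  f a < alpha -> f b < alpha.
Proof.
  intros Hab Hc Hd Ha.
  destruct (Rlt_le_dec (f b) alpha) as [|Hb]; [assumption|exfalso].
  set (E := fun s => a <= s <= b /\ forall q, a <= q <= s -> f q < alpha).
  assert (HEa : E a).
  { split; [lra|]; intros q Hq; now replace q with a by lra. }
  destruct (completeness E) as [t [Ht1 Ht2]].
  { exists b; intros s [Hs _]; lra. }
  { now exists a. }
  assert (Hat : a <= t) by now apply Ht1.
  assert (Htb : t <= b) by (apply Ht2; intros s [Hs _]; lra).
  assert (Hbelow : forall q, a <= q < t -> f q < alpha).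
  { intros q Hq; apply NNPP; intros Hn.
    assert (t <= q); [|lra].
    apply Ht2; intros s [Hs1 Hs2].
    destruct (Rle_lt_dec s q) as [|Hqs]; [assumption|].
    exfalso; apply Hn, Hs2; lra. }
  (* t is the first time at which f is no longer below alpha. *)
  destruct (Rtotal_order (f t) alpha) as [Hlt|[Heq|Hgt]].
  - destruct (continuous_near f t (alpha - f t)) as [d [Hd0 Hd1]];
      [now apply Hc | lra |].
    assert (Htb' : t < b).
    { destruct (Req_dec t b) as [->|]; lra. }
    set (s := Rmin b (t + d / 2)).
    assert (Hs : t < s <= b /\ s <= t + d / 2).
    { unfold s; repeat split; [apply Rmin_glb_lt; lra | apply Rmin_l | apply Rmin_r]. }
    assert (s <= t); [|lra].
    apply Ht1; split; [lra|]; intros q Hq.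
    destruct (Rlt_le_dec q t) as [Hqt|Hqt]; [apply Hbelow; lra|].
    specialize (Hd1 q); rewrite Rabs_pos_eq in Hd1 by lra.
    assert (H : Rabs (f q - f t) < alpha - f t) by (apply Hd1; lra).
    apply Rabs_def2 in H; lra.
  - assert (Hat' : a < t).
    { destruct (Req_dec a t) as [<-|]; lra. }
    destruct (Hd t) as [d [Hder Hneg]]; [lra | exact Heq |].
    apply is_derive_Reals in Hder.
    destruct (Hder (- d)) as [e He]; [lra|].
    set (w := Rmin ((t - a) / 2) (e / 2)).
    pose proof (cond_pos e) as He0.
    assert (Hw : 0 < w <= (t - a) / 2 /\ w <= e / 2).
    { unfold w; repeat split; [apply Rmin_glb_lt; lra | apply Rmin_l | apply Rmin_r]. }
    assert (H : Rabs ((f (t + - w) - f t) / - w - d) < - d).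
    { apply He; [lra|]; rewrite Rabs_Ropp, Rabs_pos_eq; lra. }
    apply Rabs_def2 in H; destruct H as [H _].
    assert (Hq : f (t + - w) < alpha) by (apply Hbelow; lra).
    assert (H0 : 0 < (f (t + - w) - f t) / - w).
    { replace ((f (t + - w) - f t) / - w) with ((f t - f (t + - w)) / w)
        by (field; lra).
      apply Rdiv_lt_0_compat; lra. }
    lra.
  - destruct (continuous_near f t (f t - alpha)) as [d [Hd0 Hd1]];
      [apply Hc; lra | lra |].
    assert (Hat' : a < t).
    { destruct (Req_dec a t) as [<-|]; lra. }
    set (s := Rmax a (t - d / 2)).
    assert (Hs : a <= s < t /\ t - d / 2 <= s).
    { unfold s; repeat split; [apply Rmax_l | apply Rmax_lub_lt; lra | apply Rmax_r]. }
    assert (H : Rabs (f s - f t) < f t - alpha).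
    { apply Hd1; rewrite Rabs_left; lra. }
    assert (f s < alpha) by (apply Hbelow; lra).
    apply Rabs_def2 in H; lra.
Qed.

(** If a dense set of levels is such that the bounded function [f] eventually
    stays on one side of each of them, then its lower and upper limits at
    infinity cannot be separated, hence [f] converges. *)
Lemma bounded_dichotomy_limit (f : R -> R) (A B S0 : R) :
  (forall s, S0 <= s -> A <= f s <= B) ->
  (forall a b, a < b -> exists c, a < c < b /\
     ((exists S, forall s, S <= s -> f s <= c) \/
      (exists S, forall s, S <= s -> c <= f s))) ->
  exists l : R, is_lim f p_infty l.
Proof.
  intros Hb Hdich.
  set (E := fun c => exists S, forall s, S <= s -> c <= f s).
  destruct (completeness E) as [l [Hl1 Hl2]].
  { exists B; intros c [S HS].
    pose proof (HS (Rmax S S0) (Rmax_l _ _)).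
    pose proof (Hb (Rmax S S0) (Rmax_r _ _)); lra. }
  { exists A, S0; intros s Hs; now apply Hb. }
  exists l; apply is_lim_spec; intros eps; pose proof (cond_pos eps) as He.
  assert (Hlow : exists S, forall s, S <= s -> l - eps < f s).
  { apply NNPP; intros Hn; assert (l <= l - eps); [|lra].
    apply Hl2; intros c [S HS].
    destruct (Rle_lt_dec c (l - eps)) as [|Hc]; [assumption|exfalso].
    apply Hn; exists S; intros s Hs; pose proof (HS s Hs); lra. }
  assert (Hup : exists S, forall s, S <= s -> f s < l + eps).
  { destruct (Hdich l (l + eps)) as [c [Hc [[S HS]|HS]]]; [lra| |].
    - exists S; intros s Hs; pose proof (HS s Hs); lra.
    - pose proof (Hl1 c HS); lra. }
  destruct Hlow as [S1 H1], Hup as [S2 H2].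
  exists (Rmax S1 S2); intros s Hs.
  pose proof (Rmax_l S1 S2); pose proof (Rmax_r S1 S2).
  apply Rabs_def1; [pose proof (H2 s) | pose proof (H1 s)]; lra.
Qed.

(** * Polar coordinates along a curve *)

Lemma unit_vector_angle (a b : R) :
  a ^ 2 + b ^ 2 = 1 -> exists t, a = cos t /\ b = sin t.
Proof.
  intros H.
  assert (Ha : -1 <= a <= 1) by nra.
  assert (Hs : sqrt (1 - Rsqr a) = Rabs b).
  { rewrite <- sqrt_Rsqr_abs; f_equal; unfold Rsqr; lra. }
  destruct (Rle_dec 0 b) as [Hb|Hb].
  - exists (acos a); rewrite cos_acos, sin_acos, Hs by exact Ha.
    now rewrite Rabs_pos_eq.
  - exists (- acos a); rewrite cos_neg, sin_neg, cos_acos, sin_acos, Hs by exact Ha.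
    split; [reflexivity|]; rewrite Rabs_left; lra.
Qed.

Lemma constant_on (f : R -> R) (t : R) :
  0 <= t ->
  (forall s, 0 <= s -> continuous f s) ->
  (forall s, 0 < s -> is_derive f s 0) ->
  f t = f 0.
Proof.
  intros Ht Hc Hd; apply Rle_antisym.
  - apply nonincreasing_on with (df := fun _ => 0); [exact Ht| |].
    + intros s Hs; apply Hc; lra.
    + intros s Hs; split; [apply Hd; lra | lra].
  - apply Ropp_le_cancel.
    apply nonincreasing_on with (f := fun s => - f s) (df := fun _ => 0); [exact Ht| |].
    + intros s Hs; apply (continuous_opp (V := R_NormedModule)), Hc; lra.
    + intros s Hs; split; [|lra].
      rewrite <- Ropp_0; apply (is_derive_opp (V := R_NormedModule)), Hd; lra.
Qed.

(** A curve that avoids the origin has a continuous polar angle. It is obtained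
    as the integral of the angular speed [(x y' - y x') / (x^2 + y^2)]: if
    [(a, b)] is the unit vector along [(x, y)], then [a cos + b sin] and
    [a sin - b cos], evaluated at this angle, have derivative 0. *)
Lemma polar_angle (x y dx dy : R -> R) :
  (forall t, continuous x t) -> (forall t, continuous y t) ->
  (forall t, continuous dx t) -> (forall t, continuous dy t) ->
  (forall t, 0 < x t ^ 2 + y t ^ 2) ->
  (forall t, 0 < t -> is_derive x t (dx t) /\ is_derive y t (dy t)) ->
  exists theta : R -> R,
    (forall t, continuous theta t) /\
    (forall t, 0 <= t ->
       x t = sqrt (x t ^ 2 + y t ^ 2) * cos (theta t) /\
       y t = sqrt (x t ^ 2 + y t ^ 2) * sin (theta t)) /\
    (forall t, 0 < t ->
       is_derive theta t ((x t * dy t - y t * dx t) / (x t ^ 2 + y t ^ 2))).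
Proof.
  intros Hx Hy Hdx Hdy Hpos Hder.
  set (n := fun t => x t ^ 2 + y t ^ 2).
  set (w := fun t => (x t * dy t - y t * dx t) / n t).
  assert (Hn : forall t, continuous n t).
  { intros t; now apply continuous_sum_pow2. }
  assert (Hw : forall t, continuous w t).
  { intros t; unfold w, Rdiv.
    apply continuous_Rmult.
    - apply continuous_Rminus;
        apply continuous_Rmult; auto.
    - apply continuous_comp; [apply Hn|].
      apply continuous_Rinv; apply Rgt_not_eq, Hpos. }
  assert (Hr : forall t, 0 < sqrt (n t)) by (intros; apply sqrt_lt_R0, Hpos).
  assert (Hr2 : forall t, sqrt (n t) * sqrt (n t) = n t).
  { intros; apply sqrt_sqrt, Rlt_le, Hpos. }
  assert (Hrc : forall t, continuous (fun t => sqrt (n t)) t).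
  { intros t; apply continuous_comp; [apply Hn | apply continuous_sqrt]. }
  set (a := fun t => x t / sqrt (n t)); set (b := fun t => y t / sqrt (n t)).
  assert (Hquot : forall f t, continuous f t ->
            continuous (fun t => f t / sqrt (n t)) t).
  { intros f t Hf; apply continuous_Rmult; [exact Hf|].
    apply continuous_comp; [apply Hrc | apply continuous_Rinv, Rgt_not_eq, Hr]. }
  destruct (unit_vector_angle (a 0) (b 0)) as [th0 [Ha0 Hb0]].
  { unfold a, b; pose proof (Hr 0); pose proof (Hr2 0).
    replace ((x 0 / sqrt (n 0)) ^ 2 + (y 0 / sqrt (n 0)) ^ 2) with
      ((x 0 ^ 2 + y 0 ^ 2) / (sqrt (n 0) * sqrt (n 0))) by (field; lra).
    rewrite Hr2; unfold n; field; apply Rgt_not_eq, Hpos. }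
  set (th := fun t => th0 + RInt w 0 t).
  assert (Hth : forall t, is_derive th t (w t)).
  { intros t; unfold th; rewrite <- (Rplus_0_l (w t)).
    apply (is_derive_plus (V := R_NormedModule));
      [apply (is_derive_const (V := R_NormedModule))|].
    apply (is_derive_RInt (V := R_NormedModule)) with (a := 0); [|apply Hw].
    apply filter_forall; intros s.
    apply (RInt_correct (V := R_CompleteNormedModule)),
      (ex_RInt_continuous (V := R_CompleteNormedModule)).
    intros; apply Hw. }
  assert (Hthc : forall t, continuous th t).
  { intros t; apply (ex_derive_continuous (V := R_NormedModule)); eexists; apply Hth. }
  assert (Hab : forall t, 0 < t ->
            is_derive a t (- w t * b t) /\ is_derive b t (w t * a t)).
  { intros t Ht; destruct (Hder t Ht) as [H1 H2].
    pose proof (Hr t) as Hr0; pose proof (Hr2 t) as Hr1.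
    assert (Hrne : sqrt (n t) <> 0) by lra.
    assert (E1 : n t = x t ^ 2 + y t ^ 2) by reflexivity.
    assert (Hrd : is_derive (fun t => sqrt (n t)) t
                    ((x t * dx t + y t * dy t) / sqrt (n t))).
    { unfold n; auto_derive.
      - repeat split; [now exists (dx t) | now exists (dy t) | apply Hpos].
      - derive_rewrite H1; derive_rewrite H2.
        unfold n in Hrne; simpl in Hrne; simpl; field; exact Hrne. }
    assert (Hw' : w t = (x t * dy t - y t * dx t) / (sqrt (n t) * sqrt (n t)))
      by now rewrite Hr1.
    split.
    - replace (- w t * b t) with
        ((dx t * sqrt (n t) - x t * ((x t * dx t + y t * dy t) / sqrt (n t)))
           / (sqrt (n t)) ^ 2).
      + exact (is_derive_div x (fun t => sqrt (n t)) t _ _ H1 Hrd Hrne).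
      + rewrite Hw'; unfold b.
        replace (dx t * sqrt (n t)) with (dx t * (x t ^ 2 + y t ^ 2) / sqrt (n t)).
        * field; exact Hrne.
        * rewrite <- E1; rewrite <- Hr1 at 1; field; exact Hrne.
    - replace (w t * a t) with
        ((dy t * sqrt (n t) - y t * ((x t * dx t + y t * dy t) / sqrt (n t)))
           / (sqrt (n t)) ^ 2).
      + exact (is_derive_div y (fun t => sqrt (n t)) t _ _ H2 Hrd Hrne).
      + rewrite Hw'; unfold a.
        replace (dy t * sqrt (n t)) with (dy t * (x t ^ 2 + y t ^ 2) / sqrt (n t)).
        * field; exact Hrne.
        * rewrite <- E1; rewrite <- Hr1 at 1; field; exact Hrne. }
  assert (Hth00 : th 0 = th0).
  { unfold th; rewrite (RInt_point (V := R_CompleteNormedModule)).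
    apply Rplus_0_r. }
  assert (Hcos : forall s, continuous (fun s => cos (th s)) s).
  { intros s; apply continuous_comp; [apply Hthc | apply continuous_cos]. }
  assert (Hsin : forall s, continuous (fun s => sin (th s)) s).
  { intros s; apply continuous_comp; [apply Hthc | apply continuous_sin]. }
  assert (Hac : forall s, continuous a s) by (intros; now apply Hquot).
  assert (Hbc : forall s, continuous b s) by (intros; now apply Hquot).
  assert (HP : forall t, 0 <= t -> a t * cos (th t) + b t * sin (th t) = 1).
  { intros t Ht.
    rewrite (constant_on (fun s => a s * cos (th s) + b s * sin (th s)) t Ht).
    - rewrite Hth00, Ha0, Hb0.
      pose proof (sin2_cos2 th0) as H; unfold Rsqr in H; lra.
    - intros s _; apply continuous_Rplus;
        apply continuous_Rmult; auto.
    - intros s Hs; destruct (Hab s Hs) as [H1 H2]; auto_derive.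
      + repeat split; eexists; first [exact H1 | exact H2 | exact (Hth s)].
      + pose proof (Hth s) as H3.
        derive_rewrite H1; derive_rewrite H2; derive_rewrite H3; ring. }
  assert (HQ : forall t, 0 <= t -> a t * sin (th t) - b t * cos (th t) = 0).
  { intros t Ht.
    rewrite (constant_on (fun s => a s * sin (th s) - b s * cos (th s)) t Ht).
    - rewrite Hth00, Ha0, Hb0; ring.
    - intros s _; apply continuous_Rminus;
        apply continuous_Rmult; auto.
    - intros s Hs; destruct (Hab s Hs) as [H1 H2]; auto_derive.
      + repeat split; eexists; first [exact H1 | exact H2 | exact (Hth s)].
      + pose proof (Hth s) as H3.
        derive_rewrite H1; derive_rewrite H2; derive_rewrite H3; ring. }
  exists th; split; [exact Hthc|]; split; [intros t H; split|].
  - specialize (HP t H); specialize (HQ t H).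
    pose proof (sin2_cos2 (th t)) as Hsc; unfold Rsqr in Hsc.
    assert (E : a t = cos (th t)).
    { transitivity (cos (th t) * (a t * cos (th t) + b t * sin (th t))
                    + sin (th t) * (a t * sin (th t) - b t * cos (th t))).
      - replace (a t) with (a t * 1) at 1 by ring; rewrite <- Hsc; ring.
      - rewrite HP, HQ; ring. }
    fold (n t); rewrite <- E; unfold a; field; apply Rgt_not_eq, Hr.
  - specialize (HP t H); specialize (HQ t H).
    pose proof (sin2_cos2 (th t)) as Hsc; unfold Rsqr in Hsc.
    assert (E : b t = sin (th t)).
    { transitivity (sin (th t) * (a t * cos (th t) + b t * sin (th t))
                    - cos (th t) * (a t * sin (th t) - b t * cos (th t))).
      - replace (b t) with (b t * 1) at 1 by ring; rewrite <- Hsc; ring.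
      - rewrite HP, HQ; ring. }
    fold (n t); rewrite <- E; unfold b; field; apply Rgt_not_eq, Hr.
  - intros; apply Hth.
Qed.

(** * Local existence for Lipschitz fields *)

Lemma minus_plus_id {G : AbelianGroup} (c a : G) : minus (plus c a) c = a.
Proof.
  unfold minus; rewrite (plus_comm c), <- plus_assoc.
  transitivity (plus a zero); [|apply plus_zero_r].
  apply f_equal, plus_opp_r.
Qed.

Lemma minus_plus_l {G : AbelianGroup} (c a b : G) :
  minus (plus c a) (plus c b) = minus a b.
Proof.
  rewrite (minus_trans c), minus_plus_id, <- (opp_minus (plus c b)).
  now rewrite minus_plus_id.
Qed.

Lemma norm_minus_sym {V : NormedModule R_AbsRing} (a b : V) :
  norm (minus a b) = norm (minus b a).
Proof.
  rewrite <- (norm_opp (minus a b)); apply f_equal; exact (opp_minus a b).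
Qed.

(** The Picard iteration for an [L]-Lipschitz field [F]. The existence time [h]
    depends on [L] only, which is what makes solutions continuable. *)
Section Picard.
Variable V : CompleteNormedModule R_AbsRing.
Variables (F : V -> V) (L h : R) (p0 : V).
Hypothesis hL : 0 <= L.
Hypothesis hh : 0 < h.
Hypothesis hLh : L * h <= 1 / 2.
Hypothesis hF : forall p q, norm (minus (F p) (F q)) <= L * norm (minus p q).

(** Time is clamped to [[-h, h]], so that the iterates are defined for all
    times and converge uniformly on the whole line. *)
Definition clamp (t : R) : R := Rmax (- h) (Rmin h t).

Lemma clamp_le t : Rabs (clamp t) <= h.
Proof.
  unfold clamp, Rmax, Rmin.
  repeat destruct Rle_dec; apply Rabs_le; lra.
Qed.

Lemma clamp_id t : Rabs t < h -> clamp t = t.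
Proof.
  intros [H1 H2]%Rabs_def2; unfold clamp, Rmax, Rmin.
  repeat destruct Rle_dec; lra.
Qed.

Lemma clamp_between t s :
  Rmin 0 (clamp t) <= s <= Rmax 0 (clamp t) -> clamp s = s.
Proof.
  unfold clamp, Rmax, Rmin.
  repeat destruct Rle_dec; lra.
Qed.

Lemma continuous_clamp t : continuous clamp t.
Proof.
  apply continuity_pt_filterlim.
  intros e He; exists e; split; [exact He|].
  intros x [_ Hx]; simpl in *; unfold R_dist in *.
  apply Rle_lt_trans with (2 := Hx).
  unfold clamp, Rmax, Rmin.
  repeat destruct Rle_dec; unfold Rabs; repeat destruct Rcase_abs; lra.
Qed.

Lemma lipschitz_continuous p : continuous F p.
Proof.
  apply filterlim_locally; intros eps.
  assert (He : 0 < eps / (L + 1)).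
  { apply Rdiv_lt_0_compat; [apply cond_pos | lra]. }
  refine (locally_le_locally_norm p _ _).
  exists (mkposreal _ He); intros q Hq.
  refine (norm_compat1 _ _ _ _); unfold ball_norm in Hq; simpl in Hq.
  apply Rle_lt_trans with (1 := hF q p).
  apply Rle_lt_trans with (L * (eps / (L + 1))).
  { apply Rmult_le_compat_l; [exact hL | now apply Rlt_le]. }
  replace (pos eps) with ((L + 1) * (eps / (L + 1))) at 2 by (field; lra).
  apply Rmult_lt_compat_r; [exact He | lra].
Qed.

Fixpoint picard_iter (n : nat) (t : R) : V :=
  match n with
  | O => p0
  | S n => plus p0 (RInt (fun s => F (picard_iter n s)) 0 (clamp t))
  end.

Lemma is_derive_integral (f : R -> V) t :
  (forall s, continuous f s) ->
  is_derive (fun x => RInt f 0 x) t (f t).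
Proof.
  intros Hf; apply is_derive_RInt with (a := 0); [|apply Hf].
  apply filter_forall; intros x.
  apply RInt_correct, ex_RInt_continuous; intros; apply Hf.
Qed.

Lemma continuous_step (f : R -> V) t :
  (forall s, continuous f s) ->
  continuous (fun t => plus p0 (RInt (fun s => F (f s)) 0 (clamp t))) t.
Proof.
  intros Hf; apply (continuous_plus (fun _ => p0)); [apply continuous_const|].
  apply (continuous_comp clamp (fun x => RInt (fun s => F (f s)) 0 x)).
  - apply continuous_clamp.
  - apply (ex_derive_continuous (V := V)); eexists; apply is_derive_integral.
    intros s; apply continuous_comp; [apply Hf | apply lipschitz_continuous].
Qed.

Lemma continuous_picard_iter n t : continuous (picard_iter n) t.
Proof.
  revert t; induction n as [|n IH]; intros t; simpl.
  - apply continuous_const.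
  - now apply continuous_step.
Qed.

Lemma ex_RInt_picard_iter n t :
  ex_RInt (fun s => F (picard_iter n s)) 0 t.
Proof.
  apply ex_RInt_continuous; intros s _.
  apply continuous_comp;
    [apply continuous_picard_iter | apply lipschitz_continuous].
Qed.

Lemma picard_iter_step n t :
  norm (minus (picard_iter (S n) t) (picard_iter n t))
    <= h * norm (F p0) * (1 / 2) ^ n.
Proof.
  revert t; induction n as [|n IH]; intros t.
  - simpl; rewrite Rmult_1_r.
    erewrite (minus_plus_id (G := CompleteNormedModule.AbelianGroup _ V)).
    rewrite RInt_const.
    refine (Rle_trans _ _ _ (norm_scal (clamp t - 0) (F p0)) _).
    apply Rmult_le_compat_r; [apply norm_ge_0|].
    rewrite Rminus_0_r; apply clamp_le.
  - change (picard_iter (S (S n)) t) with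
      (plus p0 (RInt (fun s => F (picard_iter (S n) s)) 0 (clamp t))).
    change (picard_iter (S n) t) with
      (plus p0 (RInt (fun s => F (picard_iter n s)) 0 (clamp t))).
    erewrite (minus_plus_l (G := CompleteNormedModule.AbelianGroup _ V)).
    rewrite <- RInt_minus by apply ex_RInt_picard_iter.
    eapply Rle_trans.
    { apply norm_RInt_le_const_abs with (a := 0) (b := clamp t)
        (f := fun s => minus (F (picard_iter (S n) s)) (F (picard_iter n s)))
        (M := L * (h * norm (F p0) * (1 / 2) ^ n)).
      - intros s _; apply Rle_trans with (1 := hF _ _).
        now apply Rmult_le_compat_l.
      - apply RInt_correct, (ex_RInt_minus (V := V)); apply ex_RInt_picard_iter. }
    rewrite Rminus_0_r.
    assert (H0 : 0 <= h * norm (F p0) * (1 / 2) ^ n).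
    { repeat apply Rmult_le_pos; [lra | apply norm_ge_0 | apply pow_le; lra]. }
    apply Rle_trans with (h * (L * (h * norm (F p0) * (1 / 2) ^ n))).
    { apply Rmult_le_compat_r; [now apply Rmult_le_pos | apply clamp_le]. }
    simpl; nra.
Qed.

Lemma picard_iter_dist n m t :
  norm (minus (picard_iter (n + m) t) (picard_iter n t))
    <= 2 * (h * norm (F p0)) * ((1 / 2) ^ n - (1 / 2) ^ (n + m)).
Proof.
  induction m as [|m IH].
  - rewrite Nat.add_0_r.
    apply Req_le, eq_trans with 0; [|ring].
    transitivity (norm (zero : V)); [apply f_equal; exact (minus_eq_zero _)|].
    apply @norm_zero.
  - rewrite Nat.add_succ_r.
    rewrite (minus_trans (picard_iter (n + m) t)).
    refine (Rle_trans _ _ _ (norm_triangle _ _) _).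
    pose proof (picard_iter_step (n + m) t) as H.
    simpl pow; lra.
Qed.

Lemma picard_iter_cauchy (eps : posreal) :
  exists N, forall n m t, (N <= n)%nat -> (N <= m)%nat ->
    norm (minus (picard_iter n t) (picard_iter m t)) < eps.
Proof.
  set (M := 4 * (h * norm (F p0)) + 1).
  assert (HM : 0 < M).
  { unfold M; pose proof (norm_ge_0 (F p0)); nra. }
  destruct (pow_lt_1_zero (1 / 2)) with (y := eps / M) as [N HN].
  { rewrite Rabs_pos_eq; lra. }
  { apply Rdiv_lt_0_compat; [apply cond_pos | exact HM]. }
  exists N.
  assert (H : forall n t, (N <= n)%nat ->
    norm (minus (picard_iter n t) (picard_iter N t)) < eps / 2).
  { intros n t Hn; replace n with (N + (n - N))%nat by lia.
    apply Rle_lt_trans with (1 := picard_iter_dist _ _ _).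
    specialize (HN N (Nat.le_refl N)).
    assert (H0 : forall j, 0 < (1 / 2) ^ j) by (intros; apply pow_lt; lra).
    rewrite Rabs_pos_eq in HN by apply Rlt_le, H0.
    apply (Rmult_lt_compat_l M) in HN; [|exact HM].
    replace (M * (eps / M)) with (pos eps) in HN by (field; lra).
    assert (0 <= h * norm (F p0)).
    { apply Rmult_le_pos; [lra | apply norm_ge_0]. }
    pose proof (H0 N); pose proof (H0 (N + (n - N))%nat).
    unfold M in HN; nra. }
  intros n m t Hn Hm.
  rewrite (minus_trans (picard_iter N t)).
  refine (Rle_lt_trans _ _ _ (norm_triangle _ _) _).
  rewrite <- (Rplus_half_diag eps); apply Rplus_lt_compat; [exact (H n t Hn)|].
  refine (Rle_lt_trans _ _ _ (Req_le _ _ _) (H m t Hm)).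
  exact (norm_minus_sym _ _).
Qed.

Lemma picard_limit :
  exists phi : R -> V,
    filterlim picard_iter eventually (locally (T := fct_UniformSpace R V) phi).
Proof.
  apply (filterlim_locally_cauchy (U := @fct_CompleteSpace R V)).
  intros eps.
  destruct (picard_iter_cauchy eps) as [N HN].
  exists (fun n => (N <= n)%nat); split; [exists N; auto|].
  intros n m Hn Hm t; refine (norm_compat1 _ _ _ _); auto.
Qed.

(** The Picard-Lindelof theorem, for autonomous systems with a globally
    Lipschitz field. *)
Lemma picard_lindelof :
  exists phi : R -> V, phi 0 = p0 /\
    forall t, Rabs t < h -> is_derive phi t (F (phi t)).
Proof.
  destruct picard_limit as [phi Hphi].
  assert (Hpt : forall t,
    filterlim (fun n => picard_iter n t) eventually (locally (phi t))).
  { intros t; apply filterlim_locally; intros eps.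
    pose proof (proj1 (filterlim_locally (U := fct_UniformSpace R V) _ _) Hphi eps) as H.
    apply filter_imp with (2 := H); intros n Hn; apply Hn. }
  assert (Hc : forall t, continuous phi t).
  { intros t.
    apply (filterlim_switch_1 eventually _ (locally t) _ picard_iter phi
             (fun n => picard_iter n t) (phi t) Hphi); [|apply Hpt].
    intros n; apply continuous_picard_iter. }
  assert (HcF : forall t, continuous (fun s => F (phi s)) t).
  { intros t; apply continuous_comp; [apply Hc | apply lipschitz_continuous]. }
  assert (HF : filterlim (fun n s => F (picard_iter n s)) eventually
                 (locally (T := fct_UniformSpace R V) (fun s => F (phi s)))).
  { apply (filterlim_locally (U := fct_UniformSpace R V)); intros eps.
    assert (He : 0 < eps / (@norm_factor _ V * (L + 1))).
    { apply Rdiv_lt_0_compat; [apply cond_pos|].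
      apply Rmult_lt_0_compat; [apply norm_factor_gt_0 | lra]. }
    pose proof (proj1 (filterlim_locally (U := fct_UniformSpace R V) _ _) Hphi
      (mkposreal _ He)) as H.
    apply filter_imp with (2 := H); intros n Hn t; refine (norm_compat1 _ _ _ _).
    pose proof (norm_compat2 _ _ _ (Hn t)) as Hn'; simpl in Hn'.
    apply Rle_lt_trans with (1 := hF _ _).
    pose proof (@norm_factor_gt_0 _ V).
    replace (norm_factor * (eps / (norm_factor * (L + 1)))) with
      (eps / (L + 1)) in Hn' by (field; lra).
    apply Rle_lt_trans with (L * (eps / (L + 1))).
    { apply Rmult_le_compat_l; [exact hL | now apply Rlt_le]. }
    pose proof (cond_pos eps).
    apply Rmult_lt_reg_r with (L + 1); [lra|].
    replace (L * (eps / (L + 1)) * (L + 1)) with (L * eps) by (field; lra).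
    nra. }
  assert (Hfix : forall t,
    phi t = plus p0 (RInt (fun s => F (phi s)) 0 (clamp t))).
  { intros t.
    destruct (filterlim_RInt (fun n s => F (picard_iter n s)) 0 (clamp t)
                eventually _ (fun s => F (phi s))
                (fun n => RInt (fun s => F (picard_iter n s)) 0 (clamp t)))
      as [I [HI1 HI2]].
    - intros n; apply RInt_correct, ex_RInt_picard_iter.
    - exact HF.
    - rewrite (is_RInt_unique _ _ _ _ HI2).
      apply (filterlim_locally_unique (F := eventually)
        (fun n => picard_iter (S n) t)).
      + apply (filterlim_comp _ _ _ S (fun n => picard_iter n t)
                 eventually eventually); [|apply Hpt].
        apply eventually_subseq; intros; lia.
      + simpl; apply (filterlim_comp_2 (F := eventually) (G := locally p0)
          (H := locally I) (fun _ => p0)); [apply filterlim_const | exact HI1 |].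
        apply (filterlim_plus p0 I). }
  exists phi; split.
  - rewrite Hfix, clamp_id by (rewrite Rabs_R0; exact hh).
    now rewrite RInt_point, plus_zero_r.
  - intros t Ht.
    apply is_derive_ext_loc with
      (fun t => plus p0 (RInt (fun s => F (phi s)) 0 t)).
    + assert (He : 0 < h - Rabs t) by lra.
      exists (mkposreal _ He); intros s Hs.
      rewrite (Hfix s), clamp_id; [reflexivity|].
      change (Rabs (s - t) < h - Rabs t) in Hs.
      pose proof (Rabs_triang (s + - t) t) as H; unfold Rminus in *.
      rewrite Rplus_assoc, Rplus_opp_l, Rplus_0_r in H; lra.
    + rewrite <- (plus_zero_l (F (phi t))).
      apply (is_derive_plus (K := R_AbsRing) (V := V));
        [apply (is_derive_const (K := R_AbsRing) (V := V))|].
      now apply is_derive_integral.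
Qed.
End Picard.

(** * Uniqueness and continuation for the damped system *)

(** The system of the theorem, with [k] in place of [beta / sqrt omega]. *)
Definition damped (k : R) : planar_system :=
  PlanarSystem (fun u _ => 0 <= u) (fun _ v => v)
    (fun u v => 1 - k * v - sqrt (2 * u)).

(** The square root [sqrt (2 * u)], frozen for [u <= 1/4] so as to be
    Lipschitz on the whole line. *)
Definition cut_sqrt (u : R) : R := sqrt (2 * Rmax u (1 / 4)).

Lemma cut_sqrt_lipschitz (a b : R) :
  Rabs (cut_sqrt a - cut_sqrt b) <= 2 * Rabs (a - b).
Proof.
  unfold cut_sqrt.
  set (p := Rmax a (1 / 4)); set (q := Rmax b (1 / 4)).
  assert (Hp : 1 / 4 <= p) by apply Rmax_r.
  assert (Hq : 1 / 4 <= q) by apply Rmax_r.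
  assert (Hpq : Rabs (p - q) <= Rabs (a - b)).
  { unfold p, q, Rmax; repeat destruct Rle_dec; unfold Rabs;
      repeat destruct Rcase_abs; lra. }
  assert (Hhalf : forall z, 1 / 4 <= z -> 1 / 2 <= sqrt (2 * z)).
  { intros z Hz; rewrite <- (sqrt_Rsqr (1 / 2)) by lra.
    apply sqrt_le_1_alt; unfold Rsqr; lra. }
  pose proof (Hhalf p Hp); pose proof (Hhalf q Hq).
  pose proof (sqrt_sqrt (2 * p)); pose proof (sqrt_sqrt (2 * q)).
  assert (E : (sqrt (2 * p) - sqrt (2 * q)) * (sqrt (2 * p) + sqrt (2 * q))
              = 2 * (p - q)) by lra.
  apply (f_equal Rabs) in E; rewrite !Rabs_mult in E.
  rewrite (Rabs_pos_eq (_ + _)), (Rabs_pos_eq 2) in E by lra.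
  pose proof (Rabs_pos (sqrt (2 * p) - sqrt (2 * q))); nra.
Qed.

Lemma cut_sqrt_eq (u : R) : 1 / 4 <= u -> cut_sqrt u = sqrt (2 * u).
Proof. intros H; unfold cut_sqrt; now rewrite Rmax_left. Qed.

(** The field of the damped system with its square root replaced by the
    Lipschitz one; the plane is encoded as the complex numbers, which carry the
    Euclidean norm and are complete. *)
Definition cut_field (k : R) (p : C) : C :=
  (snd p, 1 - k * snd p - cut_sqrt (fst p)).

Lemma cut_field_lipschitz (k : R) (p q : C_R_CompleteNormedModule) :
  0 < k ->
  norm (minus (cut_field k p : C_R_CompleteNormedModule) (cut_field k q))
    <= (3 + k) * norm (minus p q).
Proof.
  intros Hk.
  destruct p as [x y], q as [x' y'].
  change (sqrt (Rabs (y - y') ^ 2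
            + Rabs ((1 - k * y - cut_sqrt x) - (1 - k * y' - cut_sqrt x')) ^ 2)
          <= (3 + k) * sqrt (Rabs (x - x') ^ 2 + Rabs (y - y') ^ 2)).
  set (N := sqrt (Rabs (x - x') ^ 2 + Rabs (y - y') ^ 2)).
  assert (HN : 0 <= N) by apply sqrt_pos.
  assert (HN2 : N * N = Rabs (x - x') ^ 2 + Rabs (y - y') ^ 2)
    by (apply sqrt_sqrt; nra).
  pose proof (Rabs_pos (x - x')) as Hx0; pose proof (Rabs_pos (y - y')) as Hy0.
  assert (Hx : Rabs (x - x') <= N) by nra.
  assert (Hy : Rabs (y - y') <= N) by nra.
  assert (Hs : Rabs ((1 - k * y - cut_sqrt x) - (1 - k * y' - cut_sqrt x'))
               <= (2 + k) * N).
  { replace ((1 - k * y - cut_sqrt x) - (1 - k * y' - cut_sqrt x')) with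
      (- (k * (y - y')) + - (cut_sqrt x - cut_sqrt x')) by ring.
    apply Rle_trans with (1 := Rabs_triang _ _).
    rewrite !Rabs_Ropp, Rabs_mult, (Rabs_pos_eq k) by lra.
    pose proof (cut_sqrt_lipschitz x x'); nra. }
  pose proof (Rabs_pos ((1 - k * y - cut_sqrt x) - (1 - k * y' - cut_sqrt x'))).
  rewrite <- (sqrt_Rsqr ((3 + k) * N)) by nra.
  apply sqrt_le_1_alt; unfold Rsqr; nra.
Qed.

(** Solutions of the cut-off system exist for a time [h] that is the same for
    all initial points. *)
Lemma local_solution (k : R) :
  0 < k ->
  exists h, 0 < h /\ forall a b, exists phi psi : R -> R,
    phi 0 = a /\ psi 0 = b /\
    forall t, Rabs t < h ->
      is_derive phi t (psi t) /\
      is_derive psi t (1 - k * psi t - cut_sqrt (phi t)).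
Proof.
  intros Hk; exists (1 / (2 * (3 + k))); split.
  { apply Rdiv_lt_0_compat; lra. }
  intros a b.
  destruct (picard_lindelof C_R_CompleteNormedModule (cut_field k) (3 + k)
              (1 / (2 * (3 + k))) (a, b)) as [Phi [H0 Hd]].
  - lra.
  - apply Rdiv_lt_0_compat; lra.
  - right; field; lra.
  - intros p q; now apply cut_field_lipschitz.
  - exists (fun t => fst (Phi t)), (fun t => snd (Phi t)).
    rewrite H0; split; [reflexivity|]; split; [reflexivity|].
    intros t Ht; specialize (Hd t Ht); split.
    + exact (filterdiff_comp' Phi fst t _ _ Hd
        (filterdiff_linear _ (is_linear_fst
          (K := R_AbsRing) (U := R_NormedModule) (V := R_NormedModule)))).
    + exact (filterdiff_comp' Phi snd t _ _ Hd
        (filterdiff_linear _ (is_linear_snd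
          (K := R_AbsRing) (U := R_NormedModule) (V := R_NormedModule)))).
Qed.

Lemma sum_sqr_le_0 (a b : R) : a ^ 2 + b ^ 2 <= 0 -> a = 0 /\ b = 0.
Proof.
  intros H; pose proof (pow2_ge_0 a); pose proof (pow2_ge_0 b).
  split; apply Rsqr_0_uniq; unfold Rsqr; lra.
Qed.

(** Uniqueness for the cut-off system. *)
Lemma cut_system_unique (k a b : R) (x y x' y' : R -> R) :
  0 < k -> a <= b ->
  (forall t, a <= t <= b -> continuous x t /\ continuous y t /\
                            continuous x' t /\ continuous y' t) ->
  (forall t, a < t < b ->
     is_derive x t (y t) /\ is_derive y t (1 - k * y t - cut_sqrt (x t)) /\
     is_derive x' t (y' t) /\ is_derive y' t (1 - k * y' t - cut_sqrt (x' t))) ->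
  x a = x' a -> y a = y' a -> x b = x' b /\ y b = y' b.
Proof.
  intros Hk Hab Hc Hd Ea Eb.
  set (D := fun t => (x t - x' t) ^ 2 + (y t - y' t) ^ 2).
  assert (H : D b <= D a * exp (3 * (b - a))).
  { apply gronwall_on with
      (df := fun t => 2 * (x t - x' t) * (y t - y' t) +
        2 * (y t - y' t) *
        (- k * (y t - y' t) - (cut_sqrt (x t) - cut_sqrt (x' t)))); [exact Hab| |].
    - intros t Ht; destruct (Hc t Ht) as [H1 [H2 [H3 H4]]]; unfold D.
      apply continuous_sum_pow2; now apply continuous_Rminus.
    - intros t Ht; destruct (Hd t Ht) as [H1 [H2 [H3 H4]]]; split.
      + unfold D; auto_derive.
        * repeat split; eexists; first [exact H1|exact H2|exact H3|exact H4].
        * derive_rewrite H1; derive_rewrite H2; derive_rewrite H3; derive_rewrite H4.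
          ring.
      + pose proof (cut_sqrt_lipschitz (x t) (x' t)) as HL.
        unfold D; set (p := x t - x' t) in *; set (q := y t - y' t) in *.
        set (g := cut_sqrt (x t) - cut_sqrt (x' t)) in *.
        assert (Hg : g * g <= 4 * (p * p)).
        { rewrite <- (Rabs_pos_eq (g * g)), <- (Rabs_pos_eq (p * p)) by nra.
          rewrite !Rabs_mult.
          pose proof (Rabs_pos g); pose proof (Rabs_pos p).
          apply Rle_trans with ((2 * Rabs p) * (2 * Rabs p)); [|lra].
          now apply Rmult_le_compat. }
        assert (0 <= k * q ^ 2) by (apply Rmult_le_pos; [lra | apply pow2_ge_0]).
        pose proof (Rle_0_sqr (p - q)); pose proof (Rle_0_sqr (2 * q + g)).
        unfold Rsqr in *; nra. }
  assert (D a = 0) as Ha by (unfold D; rewrite Ea, Eb; ring).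
  rewrite Ha, Rmult_0_l in H; apply sum_sqr_le_0 in H; lra.
Qed.

(** The function [f] on [[0, +oo)], extended to the left by its value at 0; it
    turns one-sided continuity at 0 into two-sided continuity. *)
Definition extend_left (f : R -> R) (s : R) : R := f (Rmax 0 s).

Lemma Rbar_lt_near (s : R) (T : Rbar) :
  Rbar_lt s T -> exists d, 0 < d /\ forall q : R, q < s + d -> Rbar_lt q T.
Proof.
  destruct T as [T| |]; simpl; intros H.
  - exists (T - s); split; [lra | intros q Hq; lra].
  - exists 1; split; [lra | trivial].
  - easy.
Qed.

Lemma continuous_extend_left (T : Rbar) (f : R -> R) (s : R) :
  Rbar_lt 0 T -> Rbar_lt s T -> continuous_on (time_interval T) f ->
  continuous (extend_left f) s.
Proof.
  intros H0 HT Hf.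
  assert (Hs : time_interval T (Rmax 0 s)).
  { split; [apply Rmax_l|]; unfold Rmax; now destruct Rle_dec. }
  apply filterlim_comp with (2 := Hf _ Hs).
  assert (Hc : continuous (Rmax 0) s).
  { apply filterlim_locally; intros e; exists e; intros t Ht.
    change (Rabs (t - s) < e) in Ht; change (Rabs (Rmax 0 t - Rmax 0 s) < e).
    apply Rle_lt_trans with (2 := Ht).
    unfold Rmax; repeat destruct Rle_dec; unfold Rabs;
      repeat destruct Rcase_abs; lra. }
  intros P HP; unfold filtermap.
  apply Hc in HP; unfold filtermap in HP.
  destruct (Rbar_lt_near _ _ HT) as [d [Hd1 Hd2]].
  assert (Hnear : locally s (fun q => Rbar_lt q T)).
  { exists (mkposreal d Hd1); intros q Hq; apply Hd2.
    change (Rabs (q - s) < d) in Hq; apply Rabs_def2 in Hq; lra. }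
  generalize (filter_and _ _ HP Hnear); apply filter_imp.
  intros q [Hq1 Hq2]; apply Hq1; split; [apply Rmax_l|].
  unfold Rmax; now destruct Rle_dec.
Qed.

Lemma extend_left_eq (f : R -> R) (s : R) : 0 <= s -> extend_left f s = f s.
Proof. intros H; unfold extend_left; now rewrite Rmax_right. Qed.

Lemma locally_gt (a s : R) : a < s -> locally s (fun q => a < q).
Proof. apply (open_gt a). Qed.

Lemma is_derive_extend_left (f : R -> R) (s d : R) :
  0 < s -> is_derive f s d -> is_derive (extend_left f) s d.
Proof.
  intros Hs; apply is_derive_ext_loc.
  generalize (locally_gt 0 s Hs); apply filter_imp.
  intros q Hq; symmetry; apply extend_left_eq; lra.
Qed.

Lemma solution_extend_left (S : planar_system) (T : Rbar) (x y : R -> R) :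
  solution S T x y ->
  (forall s : R, Rbar_lt s T -> continuous (extend_left x) s /\ continuous (extend_left y) s) /\
  (forall s : R, 0 < s -> Rbar_lt s T ->
     is_derive (extend_left x) s (field1 S (extend_left x s) (extend_left y s)) /\
     is_derive (extend_left y) s (field2 S (extend_left x s) (extend_left y s))).
Proof.
  intros [H0 [_ [Hx [Hy Hd]]]]; split.
  - intros s Hs; split; now apply continuous_extend_left with T.
  - intros s Hs HT; destruct (Hd s Hs HT).
    rewrite !extend_left_eq by lra.
    now split; apply is_derive_extend_left.
Qed.

Lemma is_derive_shift (f : R -> R) (a t d : R) :
  is_derive f (t - a) d -> is_derive (fun s => f (s - a)) t d.
Proof.
  intros H; replace d with (1 * d) by ring.
  apply (is_derive_comp (V := R_NormedModule) f (fun s => s - a)); [exact H|].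
  auto_derive; [trivial | ring].
Qed.

(** A solution on a bounded time interval on which [u] stays away from the
    singularity 0 of the square root can be continued: the solution restarted
    from a time [s0] within [h / 2] of the end agrees with the given one and
    lives longer. *)
Lemma solution_extends (k tau : R) (u v : R -> R) :
  0 < k ->
  solution (damped k) tau u v ->
  (forall s, 0 <= s < tau -> 3 / 8 <= u s) ->
  exists (T1 : Rbar) (u1 v1 : R -> R),
    Rbar_lt tau T1 /\ solution (damped k) T1 u1 v1 /\
    (forall s, time_interval tau s -> u1 s = u s /\ v1 s = v s).
Proof.
  intros Hk Hsol Hu.
  destruct (local_solution k Hk) as [h [Hh Hloc]].
  destruct (solution_extend_left _ _ _ _ Hsol) as [Hcl _].
  destruct Hsol as [Htau [_ [_ [_ Hd]]]]; simpl in Htau.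
  set (s0 := Rmax (tau - h / 2) (tau / 2)).
  assert (Hs0 : 0 < s0 < tau /\ tau - h / 2 <= s0).
  { unfold s0; repeat split.
    - apply Rlt_le_trans with (2 := Rmax_r _ _); lra.
    - apply Rmax_lub_lt; lra.
    - apply Rmax_l. }
  destruct (Hloc (u s0) (v s0)) as [phi [psi [Hphi0 [Hpsi0 Hder]]]].
  set (p := fun s => phi (s - s0)); set (q := fun s => psi (s - s0)).
  assert (Hpq : forall s, s0 <= s < s0 + h ->
    is_derive p s (q s) /\ is_derive q s (1 - k * q s - cut_sqrt (p s))).
  { intros s Hs; destruct (Hder (s - s0)) as [H1 H2];
      [rewrite Rabs_pos_eq; lra|].
    unfold p, q; split.
    - now apply is_derive_shift.
    - now apply (is_derive_shift psi). }
  assert (Hagree : forall s, s0 <= s < tau -> p s = u s /\ q s = v s).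
  { intros s Hs; apply (cut_system_unique k s0 s p q u v); try lra.
    - intros t Ht; destruct (Hpq t) as [H1 H2]; [lra|].
      destruct (Hd t) as [H3 H4]; [lra | simpl; lra |].
      repeat split; eapply is_derive_continuous; eassumption.
    - intros t Ht; destruct (Hpq t) as [H1 H2]; [lra|].
      destruct (Hd t) as [H3 H4]; [lra | simpl; lra |].
      simpl in H3, H4; rewrite <- cut_sqrt_eq in H4.
      + exact (conj H1 (conj H2 (conj H3 H4))).
      + pose proof (Hu t); lra.
    - unfold p; now rewrite Rminus_diag.
    - unfold q; now rewrite Rminus_diag. }
  assert (Hpc : continuous p tau).
  { destruct (Hpq tau) as [H _]; [lra|]; exact (is_derive_continuous _ _ _ H). }
  assert (Hptau : 3 / 8 <= p tau).
  { destruct (Rle_lt_dec (3 / 8) (p tau)) as [|Hlt]; [assumption|exfalso].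
    destruct (continuous_near p tau (3 / 8 - p tau)) as [d [Hd0 Hd1]]; [|lra|].
    - exact Hpc.
    - set (s := Rmax s0 (tau - d / 2)).
      assert (Hs : s0 <= s < tau /\ tau - d / 2 <= s).
      { unfold s; repeat split; [apply Rmax_l | apply Rmax_lub_lt; lra | apply Rmax_r]. }
      assert (H : Rabs (p s - p tau) < 3 / 8 - p tau)
        by (apply Hd1; rewrite Rabs_left; lra).
      apply Rabs_def2 in H.
      destruct (Hagree s) as [E _]; [lra|].
      pose proof (Hu s); lra. }
  (* Shortly after tau, p remains in the region where the cut-off is inactive. *)
  destruct (continuous_near p tau (1 / 8)) as [d [Hd0 Hd1]]; [|lra|].
  { exact Hpc. }
  set (e := Rmin d (h / 2)).
  assert (He : 0 < e <= d /\ e <= h / 2).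
  { unfold e; repeat split; [apply Rmin_glb_lt; lra | apply Rmin_l | apply Rmin_r]. }
  set (u1 := fun s => if Rle_dec s s0 then u s else p s).
  set (v1 := fun s => if Rle_dec s s0 then v s else q s).
  assert (E1 : forall s, 0 <= s < tau -> u1 s = u s /\ v1 s = v s).
  { intros s Hs; unfold u1, v1; destruct Rle_dec; [easy|].
    apply Hagree; lra. }
  assert (E2 : forall s, s0 < s -> u1 s = p s /\ v1 s = q s).
  { intros s Hs; unfold u1, v1; destruct Rle_dec; [lra | easy]. }
  assert (Hp4 : forall s, tau <= s < tau + e -> 1 / 4 <= p s).
  { intros s Hs; assert (H : Rabs (p s - p tau) < 1 / 8)
      by (apply Hd1; rewrite Rabs_pos_eq; lra).
    apply Rabs_def2 in H; lra. }
  assert (Hder1 : forall s, 0 < s -> s < tau + e ->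
    is_derive u1 s (v1 s) /\ is_derive v1 s (1 - k * v1 s - sqrt (2 * u1 s))).
  { intros s H0 H1; destruct (Rlt_le_dec s tau) as [Hlt|Hle].
    - assert (Hloc1 : locally s (fun t => 0 <= t < tau)).
      { generalize (filter_and _ _ (locally_gt 0 s H0) (open_lt tau s Hlt)).
        apply filter_imp; intros t []; lra. }
      destruct (E1 s) as [-> ->]; [lra|].
      destruct (Hd s) as [H3 H4]; [lra | exact Hlt |].
      split; [refine (is_derive_ext_loc _ _ _ _ _ H3) |
              refine (is_derive_ext_loc _ _ _ _ _ H4)];
        generalize Hloc1; apply filter_imp; intros t Ht;
        symmetry; now apply E1.
    - destruct (E2 s) as [-> ->]; [lra|].
      destruct (Hpq s) as [H3 H4]; [lra|].
      rewrite cut_sqrt_eq in H4 by (apply Hp4; lra).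
      split; [refine (is_derive_ext_loc _ _ _ _ _ H3) |
              refine (is_derive_ext_loc _ _ _ _ _ H4)];
        (assert (Hgt : s0 < s) by lra; generalize (locally_gt s0 s Hgt);
         apply filter_imp; intros t Ht; symmetry; now apply E2). }
  assert (Hcon : forall f g : R -> R, (forall s, 0 <= s < tau -> g s = f s) ->
            continuous (extend_left f) 0 ->
            (forall s, 0 < s -> s < tau + e -> continuous g s) ->
            continuous_on (time_interval (tau + e)) g).
  { intros f g Efg Hf Hg s [H0 H1]; simpl in H1.
    destruct H0 as [H0|<-].
    - apply filterlim_filter_le_1 with (2 := Hg s H0 H1).
      apply filter_le_within.
    - intros P HP.
      rewrite Efg, <- (extend_left_eq f) in HP by lra.
      apply Hf in HP; unfold filtermap, within in *.
      generalize (filter_and _ _ HP (open_lt tau 0 Htau)); apply filter_imp.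
      intros t [Ht1 Ht2] [Ht3 _].
      rewrite extend_left_eq in Ht1 by exact Ht3.
      rewrite Efg by lra; exact Ht1. }
  destruct (Hcl 0 Htau) as [Hu0 Hv0].
  exists (tau + e), u1, v1; split; [simpl; lra|]; split.
  - split; [simpl; lra|]; split; [|split; [|split]].
    + intros s [H0 H1]; simpl in *; destruct (Rlt_le_dec s tau) as [Hlt|Hle].
      * destruct (E1 s) as [-> _]; [lra|]; pose proof (Hu s); lra.
      * destruct (E2 s) as [-> _]; [lra|]; pose proof (Hp4 s); lra.
    + apply Hcon with u; [intros; now apply E1 | exact Hu0 |].
      intros s H0 H1; destruct (Hder1 s H0 H1) as [Ha Hb].
      first [exact (is_derive_continuous _ _ _ Ha) | exact (is_derive_continuous _ _ _ Hb)].
    + apply Hcon with v; [intros; now apply E1 | exact Hv0 |].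
      intros s H0 H1; destruct (Hder1 s H0 H1) as [Ha Hb].
      first [exact (is_derive_continuous _ _ _ Ha) | exact (is_derive_continuous _ _ _ Hb)].
    + intros s H0 H1; now apply Hder1.
  - intros s [H0 H1]; now apply E1.
Qed.

(** * A quadratic Lyapunov function *)

(** The coefficient of the cross term [x * y] in the Lyapunov function. *)
Definition lyap_eps (k : R) : R := k / (1 + k ^ 2).

(** Radius of a disc in which the linear part of the field dominates. *)
Definition radius (k : R) : R := lyap_eps k / 24.

(** The Lyapunov function, in the deviations [x = u - 1/2] and [y = v]. The
    mechanical energy only decreases weakly; the cross term makes the decrease
    strict. *)
Definition lyap (k x y : R) : R := x ^ 2 + y ^ 2 + lyap_eps k * (x * y).

(** The nonlinear part of the field: with [x = u - 1/2],
    [1 - sqrt (2 * u) = - x + sqrt_remainder x]. It is nonnegative and quadratic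
    at 0. *)
Definition sqrt_remainder (x : R) : R := 1 + x - sqrt (2 * (1 / 2 + x)).

Lemma lyap_eps_bounds (k : R) :
  0 < k -> 0 < lyap_eps k <= 1 / 2 /\ lyap_eps k * (1 + k ^ 2) = k.
Proof.
  intros Hk; unfold lyap_eps.
  assert (H : 0 < 1 + k ^ 2) by nra.
  assert (E : k / (1 + k ^ 2) * (1 + k ^ 2) = k) by (field; lra).
  repeat split; [now apply Rdiv_lt_0_compat | | exact E].
  apply Rmult_le_reg_r with (1 + k ^ 2); [exact H|]; rewrite E.
  pose proof (pow2_ge_0 (k - 1)); nra.
Qed.

Lemma sqrt_remainder_bounds (x : R) : -1 / 2 <= x -> 0 <= sqrt_remainder x <= 2 * x ^ 2.
Proof.
  intros Hx; unfold sqrt_remainder.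
  (* With s = sqrt (1 + 2 x), the remainder is (s - 1)^2 / 2. *)
  set (s := sqrt (2 * (1 / 2 + x))).
  assert (Hs : 0 <= s) by apply sqrt_pos.
  assert (Hs2 : s * s = 2 * (1 / 2 + x)) by (apply sqrt_sqrt; lra).
  replace (1 + x - s) with ((s - 1) ^ 2 / 2) by nra.
  replace x with ((s - 1) * (s + 1) / 2) by nra.
  pose proof (pow2_ge_0 (s - 1)) as H.
  split; [lra|].
  replace (2 * ((s - 1) * (s + 1) / 2) ^ 2) with
    ((s - 1) ^ 2 / 2 * (s + 1) ^ 2) by field.
  assert (1 <= (s + 1) ^ 2) by nra.
  nra.
Qed.

Lemma sqrt_remainder_pos (x : R) : -1 / 2 <= x -> x <> 0 -> 0 < sqrt_remainder x.
Proof.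
  intros Hx Hne; destruct (sqrt_remainder_bounds x Hx) as [[H|H] _]; [exact H|].
  exfalso; apply Hne; unfold sqrt_remainder in H.
  set (s := sqrt (2 * (1 / 2 + x))) in *.
  assert (Hs2 : s * s = 2 * (1 / 2 + x)) by (apply sqrt_sqrt; lra).
  assert (s - 1 = 0) by (apply Rsqr_0_uniq; unfold Rsqr; lra).
  nra.
Qed.

Lemma lyap_bounds (k x y : R) :
  0 < k ->
  3 / 4 * (x ^ 2 + y ^ 2) <= lyap k x y <= 5 / 4 * (x ^ 2 + y ^ 2).
Proof.
  intros Hk; destruct (lyap_eps_bounds k Hk) as [He _]; unfold lyap.
  set (e := lyap_eps k) in *.
  assert (H : - (x ^ 2 + y ^ 2) <= 2 * (x * y) <= x ^ 2 + y ^ 2).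
  { pose proof (pow2_ge_0 (x - y)); pose proof (pow2_ge_0 (x + y)); lra. }
  split; nra.
Qed.

(** The left-hand side is the derivative of [lyap] along the flow. *)
Lemma lyap_decrease (k x y : R) :
  0 < k -> x ^ 2 + y ^ 2 <= radius k ^ 2 ->
  2 * x * y + 2 * y * (- k * y - x + sqrt_remainder x)
    + lyap_eps k * (y * y + x * (- k * y - x + sqrt_remainder x))
    <= - (lyap_eps k / 4) * (x ^ 2 + y ^ 2).
Proof.
  intros Hk Hr; destruct (lyap_eps_bounds k Hk) as [[He1 He2] Ek].
  unfold radius in Hr; set (e := lyap_eps k) in *.
  set (rho := e / 24) in *.
  assert (Hrho : 0 < rho <= 1 / 48) by (unfold rho; lra).
  pose proof (pow2_ge_0 x) as Hx2; pose proof (pow2_ge_0 y) as Hy2.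
  assert (Hx : Rabs x <= rho).
  { rewrite <- (Rabs_pos_eq rho) by lra; apply Rsqr_le_abs_0; unfold Rsqr; lra. }
  destruct (sqrt_remainder_bounds x) as [Hg0 Hg].
  { apply Rabs_le_between in Hx; lra. }
  set (g := sqrt_remainder x) in *.
  (* The nonlinear term is at most e/8 times the square of the distance. *)
  assert (Hnl : (2 * y + e * x) * g <= e / 8 * (x ^ 2 + y ^ 2)).
  { pose proof (Rabs_pos x) as Hax; pose proof (Rabs_pos y) as Hay.
    assert (Ex : Rabs x ^ 2 = x ^ 2) by apply pow2_abs.
    assert (Ey : Rabs y ^ 2 = y ^ 2) by apply pow2_abs.
    assert (H1 : (2 * y + e * x) <= 2 * Rabs y + 1 / 2 * Rabs x).
    { pose proof (Rle_abs x); pose proof (Rle_abs y).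
      apply Rplus_le_compat; [lra|].
      apply Rle_trans with (e * Rabs x); [|nra].
      apply Rmult_le_compat_l; lra. }
    assert (H2 : g <= 2 * rho * Rabs x).
    { rewrite <- Ex in Hg; nra. }
    apply Rle_trans with ((2 * Rabs y + 1 / 2 * Rabs x) * (2 * rho * Rabs x)).
    - apply Rle_trans with ((2 * Rabs y + 1 / 2 * Rabs x) * g).
      + now apply Rmult_le_compat_r.
      + apply Rmult_le_compat_l; lra.
    - replace (e / 8) with (3 * rho) by (unfold rho; field).
      rewrite <- Ex, <- Ey; set (p := Rabs x) in *; set (q := Rabs y) in *.
      assert (0 <= rho * (2 * p ^ 2 + 3 * q ^ 2 - 4 * p * q)); [|nra].
      apply Rmult_le_pos; [lra|].
      pose proof (pow2_ge_0 (p - q)); nra. }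
  (* Completing the square in the cross term. *)
  assert (Hq : 0 <= e / 2 * (x + k * y) ^ 2).
  { apply Rmult_le_pos; [lra | apply pow2_ge_0]. }
  assert (Hy : 0 <= (k - e - e * k ^ 2 / 2) * y ^ 2).
  { apply Rmult_le_pos; [|lra]; pose proof (pow2_ge_0 k); nra. }
  assert (Hk2 : e / 8 * y ^ 2 <= k * y ^ 2).
  { apply Rmult_le_compat_r; [lra|]; pose proof (pow2_ge_0 k); nra. }
  assert (Hex : 0 <= e / 2 * x ^ 2) by (apply Rmult_le_pos; lra).
  nra.
Qed.

(** * Trajectories starting near the critical point *)

(** [x] and [y] are the deviations from the critical point along a solution on
    [[0, T)], extended continuously to negative times. *)
Definition perturbed (k : R) (T : Rbar) (x y : R -> R) : Prop :=
  (forall s : R, Rbar_lt s T -> continuous x s /\ continuous y s) /\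
  (forall s : R, 0 < s -> Rbar_lt s T ->
     is_derive x s (y s) /\ is_derive y s (- k * y s - x s + sqrt_remainder (x s))).

Lemma solution_perturbed (k : R) (T : Rbar) (u v : R -> R) :
  solution (damped k) T u v ->
  perturbed k T (fun s => extend_left u s - 1 / 2) (extend_left v).
Proof.
  intros Hsol; destruct (solution_extend_left _ _ _ _ Hsol) as [Hc Hd]; split.
  - intros s Hs; destruct (Hc s Hs) as [H1 H2]; split; [|exact H2].
    apply continuous_Rminus; [exact H1 | apply continuous_const].
  - intros s H0 Hs; destruct (Hd s H0 Hs) as [H1 H2]; simpl in H1, H2; split.
    + auto_derive; [now exists (extend_left v s)|]; derive_rewrite H1; ring.
    + unfold sqrt_remainder.
      replace (1 / 2 + (extend_left u s - 1 / 2)) with (extend_left u s) by ring.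
      replace (- k * extend_left v s - (extend_left u s - 1 / 2)
               + (1 + (extend_left u s - 1 / 2) - sqrt (2 * extend_left u s)))
        with (1 - k * extend_left v s - sqrt (2 * extend_left u s)) by ring.
      exact H2.
Qed.

Lemma Rbar_lt_le_trans_R (a b : R) (T : Rbar) :
  a <= b -> Rbar_lt b T -> Rbar_lt a T.
Proof. intros H; now apply (Rbar_le_lt_trans a b T). Qed.

Lemma continuous_lyap (k : R) (x y : R -> R) (s : R) :
  continuous x s -> continuous y s -> continuous (fun s => lyap k (x s) (y s)) s.
Proof.
  intros Hx Hy.
  apply continuous_Rplus; [now apply continuous_sum_pow2|].
  apply continuous_Rmult; [apply continuous_const | now apply continuous_Rmult].
Qed.

Lemma is_derive_lyap (k : R) (T : Rbar) (x y : R -> R) (s : R) :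
  perturbed k T x y -> 0 < s -> Rbar_lt s T ->
  is_derive (fun s => lyap k (x s) (y s)) s
    (2 * x s * y s + 2 * y s * (- k * y s - x s + sqrt_remainder (x s))
     + lyap_eps k * (y s * y s + x s * (- k * y s - x s + sqrt_remainder (x s)))).
Proof.
  intros [_ Hd] H0 HT; destruct (Hd s H0 HT) as [H1 H2]; unfold lyap; auto_derive.
  - repeat split; eexists; first [exact H1 | exact H2].
  - derive_rewrite H1; derive_rewrite H2; ring.
Qed.

(** A sublevel set of [lyap] contained in the disc cannot be left. *)
Lemma perturbed_trapped (k : R) (T : Rbar) (x y : R -> R) (s : R) :
  0 < k -> perturbed k T x y ->
  x 0 ^ 2 + y 0 ^ 2 < (radius k / 2) ^ 2 ->
  0 <= s -> Rbar_lt s T ->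
  x s ^ 2 + y s ^ 2 <= radius k ^ 2.
Proof.
  intros Hk Hp H0 Hs HT.
  assert (Hrho : 0 < radius k).
  { unfold radius; destruct (lyap_eps_bounds k Hk); lra. }
  assert (Hin : forall a b, lyap k a b <= 3 / 4 * radius k ^ 2 ->
            a ^ 2 + b ^ 2 <= radius k ^ 2).
  { intros a b H; pose proof (lyap_bounds k a b Hk); lra. }
  apply Hin, Rlt_le.
  apply (barrier (fun s => lyap k (x s) (y s)) _ 0 s Hs).
  - intros t Ht; apply continuous_lyap; apply Hp;
      apply Rbar_lt_le_trans_R with s; lra || exact HT.
  - intros t Ht Et; eexists; split.
    + apply is_derive_lyap with (T := T); [exact Hp | lra |].
      apply Rbar_lt_le_trans_R with s; lra || exact HT.
    + eapply Rle_lt_trans.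
      * apply lyap_decrease; [exact Hk | apply Hin; lra].
      * pose proof (lyap_bounds k (x t) (y t) Hk).
        assert (0 < radius k ^ 2) by (apply pow_lt, Hrho).
        destruct (lyap_eps_bounds k Hk); nra.
  - pose proof (lyap_bounds k (x 0) (y 0) Hk); nra.
Qed.

Lemma perturbed_decay (k : R) (T : Rbar) (x y : R -> R) (s : R) :
  0 < k -> perturbed k T x y ->
  x 0 ^ 2 + y 0 ^ 2 < (radius k / 2) ^ 2 ->
  0 <= s -> Rbar_lt s T ->
  lyap k (x s) (y s) <= lyap k (x 0) (y 0) * exp (- (lyap_eps k / 5) * s).
Proof.
  intros Hk Hp H0 Hs HT.
  replace (- (lyap_eps k / 5) * s) with (- (lyap_eps k / 5) * (s - 0)) by ring.
  apply (gronwall_on (fun s => lyap k (x s) (y s))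
    (fun s => 2 * x s * y s + 2 * y s * (- k * y s - x s + sqrt_remainder (x s))
     + lyap_eps k * (y s * y s + x s * (- k * y s - x s + sqrt_remainder (x s))))); [exact Hs| |].
  - intros t Ht; apply continuous_lyap; apply Hp;
      apply Rbar_lt_le_trans_R with s; lra || exact HT.
  - intros t Ht.
    assert (HtT : Rbar_lt t T) by (apply Rbar_lt_le_trans_R with s; lra || exact HT).
    split; [apply is_derive_lyap with (T := T); auto; lra|].
    eapply Rle_trans.
    + apply lyap_decrease; [exact Hk|].
      apply (perturbed_trapped k T); auto; lra.
    + pose proof (lyap_bounds k (x t) (y t) Hk).
      destruct (lyap_eps_bounds k Hk); nra.
Qed.

(** The critical point is not reached in finite time: the squared distance
    decreases at most exponentially. *)
Lemma perturbed_positive (k : R) (T : Rbar) (x y : R -> R) (s : R) :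
  0 < k -> perturbed k T x y ->
  x 0 ^ 2 + y 0 ^ 2 < (radius k / 2) ^ 2 ->
  0 <= s -> Rbar_lt s T ->
  0 < x 0 ^ 2 + y 0 ^ 2 -> 0 < x s ^ 2 + y s ^ 2.
Proof.
  intros Hk Hp H0 Hs HT Hpos.
  assert (H : - (x s ^ 2 + y s ^ 2) <=
              - (x 0 ^ 2 + y 0 ^ 2) * exp (- (2 * k + 1) * (s - 0))).
  { apply (gronwall_on (fun s => - (x s ^ 2 + y s ^ 2))
      (fun s => - (2 * x s * y s + 2 * y s * (- k * y s - x s + sqrt_remainder (x s)))));
      [exact Hs| |].
    - intros t Ht.
      destruct (proj1 Hp t) as [Hx Hy].
      { apply Rbar_lt_le_trans_R with s; lra || exact HT. }
      apply (continuous_opp (V := R_NormedModule)).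
      now apply continuous_sum_pow2.
    - intros t Ht.
      assert (HtT : Rbar_lt t T)
        by (apply Rbar_lt_le_trans_R with s; lra || exact HT).
      destruct (proj2 Hp t) as [H1 H2]; [lra | exact HtT |]; split.
      + auto_derive; [repeat split; eexists; first [exact H1 | exact H2]|].
        derive_rewrite H1; derive_rewrite H2; ring.
      + assert (Htr : x t ^ 2 + y t ^ 2 <= radius k ^ 2)
          by (apply (perturbed_trapped k T); auto; lra).
        assert (Hrho : 0 < radius k <= 1 / 48).
        { unfold radius; destruct (lyap_eps_bounds k Hk); lra. }
        pose proof (pow2_ge_0 (x t)); pose proof (pow2_ge_0 (y t)).
        assert (Hx : Rabs (x t) <= radius k).
        { rewrite <- (Rabs_pos_eq (radius k)) by lra.
          apply Rsqr_le_abs_0; unfold Rsqr; lra. }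
        apply Rabs_le_between in Hx.
        destruct (sqrt_remainder_bounds (x t)) as [Hg0 Hg]; [lra|].
        assert (Hx4 : x t ^ 2 <= 1 / 4) by nra.
        assert (Hg2 : sqrt_remainder (x t) ^ 2 <= x t ^ 2).
        { apply Rle_trans with (2 * x t ^ 2 * (2 * x t ^ 2)); [|nra].
          simpl (sqrt_remainder (x t) ^ 2); rewrite Rmult_1_r; now apply Rmult_le_compat. }
        assert (0 <= k * x t ^ 2) by (apply Rmult_le_pos; lra).
        pose proof (pow2_ge_0 (y t + sqrt_remainder (x t))); lra. }
  pose proof (exp_pos (- (2 * k + 1) * (s - 0))); nra.
Qed.

(** If the maximal time were finite, the trapped trajectory could be continued. *)
Lemma near_trajectory_global (k : R) (T : Rbar) (u v : R -> R) :
  0 < k -> trajectory (damped k) T u v ->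
  (u 0 - 1 / 2) ^ 2 + v 0 ^ 2 < (radius k / 2) ^ 2 ->
  T = p_infty.
Proof.
  intros Hk [Hsol Hmax] H0.
  destruct T as [tau| |]; [exfalso | reflexivity | now destruct Hsol].
  apply Hmax, (solution_extends k); [exact Hk | exact Hsol |].
  intros s [Hs1 Hs2].
  pose proof (perturbed_trapped k tau _ _ s Hk (solution_perturbed _ _ _ _ Hsol)) as H.
  simpl in H; rewrite !extend_left_eq in H by lra.
  specialize (H ltac:(simpl in *; lra) Hs1 Hs2).
  assert (Hrho : 0 < radius k <= 1 / 48).
  { unfold radius; destruct (lyap_eps_bounds k Hk); lra. }
  pose proof (pow2_ge_0 (v s)); simpl in *; nra.
Qed.

(** The angular velocity of the damped system at the point with polar
    coordinates [r], [th] around the critical point. *)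
Definition angular_velocity (k r th : R) : R :=
  - (1 + k * (sin th * cos th)) + cos th * sqrt_remainder (r * cos th) / r.

Lemma near_trajectory_polar (k : R) (u v : R -> R) :
  0 < k -> trajectory (damped k) p_infty u v -> nonconstant p_infty u v ->
  (u 0 - 1 / 2) ^ 2 + v 0 ^ 2 < (radius k / 2) ^ 2 ->
  exists r theta : R -> R,
    polar_coordinates (1 / 2, 0) p_infty u v r theta /\
    is_lim r p_infty 0 /\
    (forall s, 0 < s -> 0 < r s <= 1 / 48) /\
    (forall s, 0 < s -> is_derive theta s (angular_velocity k (r s) (theta s))).
Proof.
  intros Hk [Hsol _] Hnc H0.
  pose proof (solution_perturbed _ _ _ _ Hsol) as Hp.
  set (x := fun s => extend_left u s - 1 / 2) in *; set (y := extend_left v) in *.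
  assert (Ex : forall s, 0 <= s -> x s = u s - 1 / 2).
  { intros s Hs; unfold x; now rewrite extend_left_eq. }
  assert (Ey : forall s, 0 <= s -> y s = v s).
  { intros s Hs; unfold y; now rewrite extend_left_eq. }
  rewrite <- Ex, <- Ey in H0 by lra.
  assert (Hpos0 : 0 < x 0 ^ 2 + y 0 ^ 2).
  { destruct (Rle_lt_dec (x 0 ^ 2 + y 0 ^ 2) 0) as [Hz|]; [exfalso|assumption].
    destruct Hnc as [s [[Hs _] Hne]]; apply Hne.
    pose proof (perturbed_decay k p_infty x y s Hk Hp H0 Hs I) as Hd.
    pose proof (lyap_bounds k (x 0) (y 0) Hk) as Hb0.
    pose proof (lyap_bounds k (x s) (y s) Hk) as Hbs.
    pose proof (exp_pos (- (lyap_eps k / 5) * s)).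
    assert (Hzs : x s ^ 2 + y s ^ 2 <= 0) by nra.
    apply sum_sqr_le_0 in Hz; apply sum_sqr_le_0 in Hzs.
    rewrite Ex, Ey in Hz by lra; rewrite Ex, Ey in Hzs by lra.
    f_equal; lra. }
  assert (Hpos : forall t, 0 < x t ^ 2 + y t ^ 2).
  { intros t.
    assert (E : x t ^ 2 + y t ^ 2 = x (Rmax 0 t) ^ 2 + y (Rmax 0 t) ^ 2).
    { unfold x, y, extend_left; now rewrite (Rmax_right 0 (Rmax 0 t)) by apply Rmax_l. }
    rewrite E; apply (perturbed_positive k p_infty); auto; [apply Rmax_l | exact I]. }
  destruct Hp as [Hc Hd].
  assert (Hp : perturbed k p_infty x y) by now split.
  assert (Hgc : forall t, continuous (fun t => sqrt_remainder (x t)) t).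
  { intros t; unfold sqrt_remainder.
    apply continuous_Rminus.
    - apply continuous_Rplus;
        [apply continuous_const | now apply Hc].
    - apply (continuous_comp (fun t => 2 * (1 / 2 + x t)) sqrt);
        [|apply continuous_sqrt].
      apply continuous_Rmult; [apply continuous_const|].
      apply continuous_Rplus;
        [apply continuous_const | now apply Hc]. }
  destruct (polar_angle x y y (fun t => - k * y t - x t + sqrt_remainder (x t)))
    as [th [Hth1 [Hth2 Hth3]]].
  - intros t; now apply Hc.
  - intros t; now apply Hc.
  - intros t; now apply Hc.
  - intros t; apply continuous_Rplus; [|apply Hgc].
    apply continuous_Rminus; [|now apply Hc].
    apply continuous_Rmult; [apply continuous_const | now apply Hc].
  - exact Hpos.
  - intros t Ht; now apply Hd.
  - set (r := fun t => sqrt (x t ^ 2 + y t ^ 2)) in *.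
    assert (Hr : forall t, 0 < r t) by (intros; apply sqrt_lt_R0, Hpos).
    assert (Hr2 : forall t, r t * r t = x t ^ 2 + y t ^ 2).
    { intros; apply sqrt_sqrt, Rlt_le, Hpos. }
    exists r, th; split; [split|split; [|split]].
    + intros s [Hs _]; destruct (Hth2 s Hs) as [E1 E2].
      split; [apply Hr|]; fold (r s) in E1, E2; simpl; rewrite <- E1, <- E2.
      rewrite Ex, Ey by exact Hs; split; ring.
    + intros s _; apply filterlim_filter_le_1 with (2 := Hth1 s).
      apply filter_le_within.
    + destruct (lyap_eps_bounds k Hk) as [He _].
      assert (Hlim : is_lim (fun s => lyap k (x 0) (y 0) * (4 / 3)
                        * exp (- (lyap_eps k / 5) * s)) p_infty 0).
      { replace (Finite 0) with
          (Rbar_mult (lyap k (x 0) (y 0) * (4 / 3)) 0) by (simpl; f_equal; ring).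
        apply is_lim_scal_l.
        apply is_lim_comp with m_infty.
        - apply is_lim_exp_m.
        - replace m_infty with (Rbar_mult (- (lyap_eps k / 5)) p_infty).
          + apply (is_lim_scal_l (fun s => s)), is_lim_id.
          + apply is_Rbar_mult_unique, is_Rbar_mult_sym, is_Rbar_mult_p_infty_neg.
            simpl; lra.
        - exists 0; intros; discriminate. }
      apply is_lim_spec in Hlim; apply is_lim_spec; intros eps.
      assert (Hee : 0 < eps * eps) by (apply Rmult_lt_0_compat; apply cond_pos).
      destruct (Hlim (mkposreal _ Hee)) as [S HS]; simpl in HS.
      exists (Rmax 0 S); intros s Hs.
      pose proof (Rmax_l 0 S); pose proof (Rmax_r 0 S).
      specialize (HS s ltac:(lra)); apply Rabs_def2 in HS.
      pose proof (perturbed_decay k p_infty x y s Hk Hp H0 ltac:(lra) I) as Hdec.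
      pose proof (lyap_bounds k (x s) (y s) Hk) as Hb.
      rewrite Rminus_0_r, Rabs_pos_eq by apply Rlt_le, Hr.
      pose proof (cond_pos eps); pose proof (Hr s); pose proof (Hr2 s).
      apply Rsqr_incrst_0; unfold Rsqr; lra.
    + intros s Hs; split; [apply Hr|].
      pose proof (perturbed_trapped k p_infty x y s Hk Hp H0 ltac:(lra) I) as Htr.
      assert (Hrho : 0 < radius k <= 1 / 48).
      { unfold radius; destruct (lyap_eps_bounds k Hk); lra. }
      pose proof (Hr s); pose proof (Hr2 s).
      apply Rle_trans with (radius k); [|lra].
      apply Rsqr_incr_0; unfold Rsqr; lra.
    + intros s Hs; destruct (Hth2 s) as [E1 E2]; [lra|].
      fold (r s) in E1, E2.
      replace (angular_velocity k (r s) (th s)) with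
        ((x s * (- k * y s - x s + sqrt_remainder (x s)) - y s * y s) / (x s ^ 2 + y s ^ 2)).
      * now apply Hth3.
      * unfold angular_velocity; rewrite <- E1, <- Hr2.
        pose proof (sin2_cos2 (th s)) as Hsc; unfold Rsqr in Hsc.
        pose proof (Hr s) as Hrs.
        replace (x s * (- k * y s - x s + sqrt_remainder (x s)) - y s * y s) with
          (- (x s ^ 2 + y s ^ 2) - k * (x s * y s) + x s * sqrt_remainder (x s)) by ring.
        rewrite <- Hr2; set (g := sqrt_remainder (x s)).
        rewrite E1, E2; field; lra.
Qed.

(** * Asymptotic behaviour of the polar angle *)

(** The angular velocity of the linearized system, up to sign. It vanishes at
    the directions of the real eigenvectors. *)
Definition turning (k th : R) : R := 1 + k * (sin th * cos th).

Lemma angular_velocity_turning (k r th : R) :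
  0 < r <= 1 / 48 -> Rabs (angular_velocity k r th + turning k th) <= 2 * r.
Proof.
  intros Hr; unfold angular_velocity, turning.
  replace (- (1 + k * (sin th * cos th)) + cos th * sqrt_remainder (r * cos th) / r
           + (1 + k * (sin th * cos th)))
    with (cos th * (sqrt_remainder (r * cos th) / r)) by (field; lra).
  set (c := cos th).
  assert (Hc : Rabs c <= 1) by (apply Rabs_le; apply COS_bound).
  pose proof (Rabs_pos c) as Hc0.
  assert (Hrc : Rabs (r * c) <= 1 / 2).
  { rewrite Rabs_mult, (Rabs_pos_eq r) by lra; nra. }
  apply Rabs_le_between in Hrc.
  destruct (sqrt_remainder_bounds (r * c)) as [Hg0 Hg]; [lra|].
  assert (Hc2 : c ^ 2 <= 1) by (rewrite <- pow2_abs; nra).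
  assert (Hq : 0 <= sqrt_remainder (r * c) / r <= 2 * r).
  { split; [apply Rdiv_le_0_compat; lra|].
    apply Rmult_le_reg_r with r; [lra|].
    replace (sqrt_remainder (r * c) / r * r) with (sqrt_remainder (r * c)) by (field; lra); nra. }
  rewrite Rabs_mult, (Rabs_pos_eq (sqrt_remainder (r * c) / r)) by lra; nra.
Qed.

(** What is used of a trajectory in polar coordinates around the critical
    point; the bound 1/48 keeps it where the square root is smooth. *)
Definition polar_motion (k : R) (r theta : R -> R) : Prop :=
  is_lim r p_infty 0 /\
  (forall s, 0 < s -> 0 < r s <= 1 / 48) /\
  (forall s, 0 < s -> is_derive theta s (angular_velocity k (r s) (theta s))).

Lemma polar_motion_small (k e : R) (r theta : R -> R) :
  polar_motion k r theta -> 0 < e ->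
  exists S, 0 < S /\ forall s, S <= s -> 0 < r s <= 1 / 48 /\ r s < e.
Proof.
  intros [Hlim [Hr _]] He; apply is_lim_spec in Hlim.
  destruct (Hlim (mkposreal e He)) as [S HS]; simpl in HS.
  exists (Rmax 0 S + 1); pose proof (Rmax_l 0 S); pose proof (Rmax_r 0 S).
  split; [lra|]; intros s Hs.
  specialize (Hr s ltac:(lra)); specialize (HS s ltac:(lra)).
  rewrite Rminus_0_r in HS; apply Rabs_def2 in HS; lra.
Qed.

Lemma polar_motion_continuous (k s : R) (r theta : R -> R) :
  polar_motion k r theta -> 0 < s -> continuous theta s.
Proof.
  intros [_ [_ Hd]] Hs; exact (is_derive_continuous _ _ _ (Hd s Hs)).
Qed.

Lemma polar_motion_linear_decrease (k m S : R) (r theta : R -> R) :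
  polar_motion k r theta -> 0 < S ->
  (forall s, S <= s -> angular_velocity k (r s) (theta s) <= - m) ->
  forall s, S <= s -> theta s <= theta S - m * (s - S).
Proof.
  intros Hsp HS Hm s Hs.
  assert (H : theta s + m * s <= theta S + m * S).
  { apply (nonincreasing_on (fun t => theta t + m * t)
      (fun t => angular_velocity k (r t) (theta t) + m)); [exact Hs| |].
    - intros t Ht; apply continuous_Rplus.
      + apply (polar_motion_continuous k t r theta Hsp); lra.
      + apply continuous_Rmult; [apply continuous_const | apply continuous_id].
    - intros t Ht; destruct Hsp as [_ [_ Hd]].
      assert (H1 := Hd t ltac:(lra)); split.
      + auto_derive; [eexists; exact H1|]; derive_rewrite H1; ring.
      + pose proof (Hm t ltac:(lra)); lra. }
  lra.
Qed.

Lemma polar_motion_angle_unbounded (k : R) (r theta : R -> R) :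
  0 < k < 2 -> polar_motion k r theta ->
  is_lim (fun s => Rabs (theta s)) p_infty p_infty.
Proof.
  intros Hk Hsp; set (m := (1 - k / 2) / 2).
  assert (Hm : 0 < m) by (unfold m; lra).
  destruct (polar_motion_small k (m / 2) r theta Hsp) as [S [HS0 HS]]; [lra|].
  assert (Hdec : forall s, S <= s -> theta s <= theta S - m * (s - S)).
  { apply (polar_motion_linear_decrease k m S r theta Hsp HS0); intros s Hs.
    destruct (HS s Hs) as [H1 H2].
    pose proof (angular_velocity_turning k (r s) (theta s) H1) as H3.
    apply Rabs_le_between in H3.
    assert (1 - k / 2 <= turning k (theta s)).
    { unfold turning; pose proof (sin2_cos2 (theta s)) as Hsc.
      pose proof (Rle_0_sqr (sin (theta s) + cos (theta s))).
      unfold Rsqr in *; nra. }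
    unfold m in *; lra. }
  apply is_lim_spec; intros M.
  set (s1 := S + (Rabs (theta S) + Rabs M) / m).
  exists s1; intros s Hs.
  pose proof (Rle_abs (theta S)); pose proof (Rle_abs M).
  pose proof (Rabs_pos (theta S)); pose proof (Rabs_pos M).
  assert (0 <= (Rabs (theta S) + Rabs M) / m) by (apply Rdiv_le_0_compat; lra).
  assert (Hs' : Rabs (theta S) + Rabs M < m * (s - S)).
  { replace (Rabs (theta S) + Rabs M) with
      (m * ((Rabs (theta S) + Rabs M) / m)) by (field; lra).
    apply Rmult_lt_compat_l; unfold s1 in Hs; lra. }
  specialize (Hdec s ltac:(unfold s1 in Hs; lra)).
  pose proof (Rabs_maj2 (theta s)); lra.
Qed.

Lemma polar_motion_upper_barrier (k S c : R) (r theta : R -> R) :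
  polar_motion k r theta -> 0 < S ->
  (forall s, S <= s -> theta s = c -> angular_velocity k (r s) (theta s) < 0) ->
  theta S < c -> forall s, S <= s -> theta s < c.
Proof.
  intros Hsp HS Hneg Hc s Hs.
  apply (barrier theta c S s Hs); [| |exact Hc].
  - intros t Ht; apply (polar_motion_continuous k t r theta Hsp); lra.
  - intros t Ht Et; eexists; split; [apply Hsp; lra | apply Hneg; lra].
Qed.

Lemma polar_motion_lower_barrier (k S c : R) (r theta : R -> R) :
  polar_motion k r theta -> 0 < S ->
  (forall s, S <= s -> theta s = c -> 0 < angular_velocity k (r s) (theta s)) ->
  c < theta S -> forall s, S <= s -> c < theta s.
Proof.
  intros Hsp HS Hpos Hc s Hs; apply Ropp_lt_cancel.
  apply (barrier (fun t => - theta t) (- c) S s Hs); [| |lra].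
  - intros t Ht; apply (continuous_opp (V := R_NormedModule)).
    apply (polar_motion_continuous k t r theta Hsp); lra.
  - intros t Ht Et; exists (- angular_velocity k (r t) (theta t)); split.
    + apply (is_derive_opp (V := R_NormedModule)), Hsp; lra.
    + pose proof (Hpos t ltac:(lra) ltac:(lra)); lra.
Qed.

Lemma nat_turns_above (a : R) : exists n, a < 2 * INR n * PI.
Proof.
  pose proof PI_RGT_0 as Hpi.
  destruct (INR_unbounded (a / (2 * PI))) as [n Hn]; exists n.
  apply (Rmult_lt_compat_r (2 * PI)) in Hn; [|lra].
  replace (a / (2 * PI) * (2 * PI)) with a in Hn by (field; lra); lra.
Qed.

(** For [k >= 2] the angle cannot cross [2 n PI] upwards nor
    [- PI / 4 - 2 m PI] downwards. In the second direction the linear part of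
    the angular velocity is [k / 2 - 1 >= 0]; for [k = 2] it vanishes, and it is
    the positivity of [sqrt_remainder] that decides. *)
Lemma polar_motion_bounded (k : R) (r theta : R -> R) :
  2 <= k -> polar_motion k r theta ->
  exists A B, forall s, 1 <= s -> A <= theta s <= B.
Proof.
  intros Hk Hsp.
  destruct (nat_turns_above (theta 1)) as [n Hn].
  destruct (nat_turns_above (- theta 1)) as [m Hm].
  exists (- (PI / 4) - 2 * INR m * PI), (2 * INR n * PI); intros s Hs.
  pose proof PI_RGT_0 as Hpi.
  split; apply Rlt_le.
  - apply (polar_motion_lower_barrier k 1 _ r theta Hsp); [lra| |lra|exact Hs].
    intros t Ht Et.
    assert (Hc : cos (theta t) = 1 / sqrt 2).
    { rewrite <- (cos_period _ m), Et.
      replace (- (PI / 4) - 2 * INR m * PI + 2 * INR m * PI) with (- (PI / 4)) by ring.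
      rewrite cos_neg; apply cos_PI4. }
    assert (Hsn : sin (theta t) = - (1 / sqrt 2)).
    { rewrite <- (sin_period _ m), Et.
      replace (- (PI / 4) - 2 * INR m * PI + 2 * INR m * PI) with (- (PI / 4)) by ring.
      rewrite sin_neg, sin_PI4; reflexivity. }
    assert (H2 : 0 < sqrt 2) by (apply sqrt_lt_R0; lra).
    assert (H22 : sqrt 2 * sqrt 2 = 2) by (apply sqrt_sqrt; lra).
    assert (Hr : 0 < r t <= 1 / 48) by (apply Hsp; lra).
    unfold angular_velocity; rewrite Hsn, Hc.
    replace (- (1 / sqrt 2) * (1 / sqrt 2)) with (- (1 / 2)).
    2: { rewrite <- H22 at 1; field; lra. }
    assert (Hc0 : 0 < 1 / sqrt 2) by (apply Rdiv_lt_0_compat; lra).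
    assert (Hrc : 0 < r t * (1 / sqrt 2)) by (apply Rmult_lt_0_compat; lra).
    assert (Hg : 0 < sqrt_remainder (r t * (1 / sqrt 2)))
      by (apply sqrt_remainder_pos; [lra | now apply Rgt_not_eq]).
    assert (0 < 1 / sqrt 2 * sqrt_remainder (r t * (1 / sqrt 2)) / r t).
    { apply Rdiv_lt_0_compat; [now apply Rmult_lt_0_compat | lra]. }
    lra.
  - apply (polar_motion_upper_barrier k 1 _ r theta Hsp); [lra| |exact Hn|exact Hs].
    intros t Ht Et.
    assert (Hsn : sin (theta t) = 0).
    { rewrite Et, <- (Rplus_0_l (2 * INR n * PI)), sin_period; apply sin_0. }
    assert (Hr : 0 < r t <= 1 / 48) by (apply Hsp; lra).
    pose proof (angular_velocity_turning k (r t) (theta t) Hr) as H.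
    unfold turning in H; rewrite Hsn in H; apply Rabs_le_between in H; lra.
Qed.

Lemma turning_nonzero_dense (k a b : R) :
  a < b -> exists c, a < c < b /\ turning k c <> 0.
Proof.
  intros Hab; apply NNPP; intros Hn.
  assert (Hz : forall c, a < c < b -> turning k c = 0).
  { intros c Hc; apply NNPP; intros H; apply Hn; now exists c. }
  set (m := (a + b) / 2); set (d := Rmin ((b - a) / 4) 1).
  assert (Hd : 0 < d <= (b - a) / 4 /\ d <= 1).
  { unfold d; repeat split; [apply Rmin_glb_lt; lra | apply Rmin_l | apply Rmin_r]. }
  assert (H2 : forall c, turning k c = 1 + k / 2 * sin (2 * c)).
  { intros c; unfold turning; rewrite sin_2a; field. }
  pose proof (Hz m ltac:(unfold m; lra)) as H0.
  pose proof (Hz (m + d) ltac:(unfold m; lra)) as Hp.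
  pose proof (Hz (m - d) ltac:(unfold m; lra)) as Hm.
  rewrite H2 in H0, Hp, Hm.
  (* Zeros at m - d, m and m + d would force cos (2 d) = 1. *)
  replace (2 * (m + d)) with (2 * m + 2 * d) in Hp by ring.
  replace (2 * (m - d)) with (2 * m - 2 * d) in Hm by ring.
  rewrite sin_plus in Hp; rewrite sin_minus in Hm.
  rewrite (cos_2a_sin d) in Hp, Hm.
  assert (Hs : 0 < sin d).
  { apply sin_gt_0; [lra|]; pose proof PI2_1; lra. }
  set (S := sin (2 * m)) in *.
  assert (E : k / 2 * S * (sin d * sin d) = 0) by lra.
  assert (E' : k / 2 * S = -1) by lra.
  rewrite E' in E; nra.
Qed.

(** Close to the critical point, a direction that is not an eigenvector of the
    linear part is crossed in one sense only. *)
Lemma polar_motion_dichotomy (k c : R) (r theta : R -> R) :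
  polar_motion k r theta -> turning k c <> 0 ->
  (exists S, forall s, S <= s -> theta s <= c) \/
  (exists S, forall s, S <= s -> c <= theta s).
Proof.
  intros Hsp Hc.
  assert (Hpos : 0 < Rabs (turning k c) / 2).
  { pose proof (Rabs_pos_lt _ Hc); lra. }
  destruct (polar_motion_small k _ r theta Hsp Hpos) as [S [HS0 HS]].
  assert (Hang : forall s, S <= s -> theta s = c ->
    Rabs (angular_velocity k (r s) (theta s) + turning k c) < Rabs (turning k c)).
  { intros s Hs Es; destruct (HS s Hs) as [H1 H2].
    rewrite <- Es at 1.
    pose proof (angular_velocity_turning k (r s) (theta s) H1); lra. }
  destruct (Rdichotomy _ _ Hc) as [Hneg|Hgt].
  - destruct (classic (exists s, S <= s /\ c < theta s)) as [[s1 [Hs1 H1]]|Hn].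
    + right; exists s1; intros s Hs; apply Rlt_le.
      apply (polar_motion_lower_barrier k s1 c r theta Hsp); [lra| |exact H1|exact Hs].
      intros t Ht Et; pose proof (Hang t ltac:(lra) Et) as H.
      rewrite (Rabs_left (turning k c)) in H by exact Hneg.
      apply Rabs_def2 in H; lra.
    + left; exists S; intros s Hs; apply Rnot_lt_le; intros H.
      apply Hn; now exists s.
  - destruct (classic (exists s, S <= s /\ theta s < c)) as [[s1 [Hs1 H1]]|Hn].
    + left; exists s1; intros s Hs; apply Rlt_le.
      apply (polar_motion_upper_barrier k s1 c r theta Hsp); [lra| |exact H1|exact Hs].
      intros t Ht Et; pose proof (Hang t ltac:(lra) Et) as H.
      rewrite (Rabs_pos_eq (turning k c)) in H by lra.
      apply Rabs_def2 in H; lra.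
    + right; exists S; intros s Hs; apply Rnot_lt_le; intros H.
      apply Hn; now exists s.
Qed.

Lemma polar_motion_angle_limit (k : R) (r theta : R -> R) :
  2 <= k -> polar_motion k r theta -> exists l : R, is_lim theta p_infty l.
Proof.
  intros Hk Hsp; destruct (polar_motion_bounded k r theta Hk Hsp) as [A [B Hb]].
  apply (bounded_dichotomy_limit theta A B 1 Hb); intros a b Hab.
  destruct (turning_nonzero_dense k a b Hab) as [c [Hc1 Hc2]].
  exists c; split; [exact Hc1 | exact (polar_motion_dichotomy k c r theta Hsp Hc2)].
Qed.

(** Otherwise the angle would decrease linearly. For [k = 2], where [turning]
    is the square of [sin + cos], this determines the limiting line. *)
Lemma polar_motion_limit_turning (k l : R) (r theta : R -> R) :
  polar_motion k r theta -> is_lim theta p_infty l -> turning k l <= 0.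
Proof.
  intros Hsp Hl; apply Rnot_lt_le; intros Hpos.
  set (m := turning k l / 4) in *; assert (Hm : 0 < m) by (unfold m; lra).
  assert (Hcont : continuous (turning k) l).
  { apply (ex_derive_continuous (V := R_NormedModule)); unfold turning.
    auto_derive; trivial. }
  destruct (continuous_near (turning k) l m Hcont Hm) as [d [Hd0 Hd]].
  destruct (polar_motion_small k m r theta Hsp Hm) as [S1 [HS1 HS]].
  apply is_lim_spec in Hl.
  destruct (Hl (mkposreal d Hd0)) as [S2 HS2]; simpl in HS2.
  destruct (Hl (mkposreal 1 Rlt_0_1)) as [S3 HS3]; simpl in HS3.
  set (S := Rmax S1 (Rmax S2 S3) + 1).
  pose proof (Rmax_l S1 (Rmax S2 S3)); pose proof (Rmax_r S1 (Rmax S2 S3)).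
  pose proof (Rmax_l S2 S3); pose proof (Rmax_r S2 S3).
  assert (Hdec : forall s, S <= s -> theta s <= theta S - m * (s - S)).
  { apply (polar_motion_linear_decrease k m S r theta Hsp); [unfold S; lra|].
    intros s Hs; destruct (HS s) as [H3 H4]; [unfold S in Hs; lra|].
    pose proof (angular_velocity_turning k (r s) (theta s) H3) as H5.
    pose proof (Hd _ (HS2 s ltac:(unfold S in Hs; lra))) as H6.
    apply Rabs_le_between in H5; apply Rabs_def2 in H6; unfold m in *; lra. }
  pose proof (HS3 S ltac:(unfold S; lra)) as HA.
  set (s := S + 2 / m).
  assert (H2m : 0 < 2 / m) by (apply Rdiv_lt_0_compat; lra).
  pose proof (HS3 s ltac:(unfold s, S in *; lra)) as HB.
  pose proof (Hdec s ltac:(unfold s; lra)) as HC.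
  replace (m * (s - S)) with 2 in HC by (unfold s; field; lra).
  apply Rabs_def2 in HA; apply Rabs_def2 in HB; lra.
Qed.

Lemma nearby_of_polar_motion (k : R) (P : (R -> R) -> (R -> R) -> Prop) :
  0 < k -> (forall r theta, polar_motion k r theta -> P r theta) ->
  nearby_trajectories (damped k) (1 / 2, 0) P.
Proof.
  intros Hk HP; exists (radius k / 2).
  assert (Hrho : 0 < radius k).
  { unfold radius; destruct (lyap_eps_bounds k Hk); lra. }
  split; [lra|]; intros T u v Htr Hnc H0; simpl in H0.
  rewrite !Rmult_1_r, Rminus_0_r in H0.
  assert (H0' : (u 0 - 1 / 2) ^ 2 + v 0 ^ 2 < (radius k / 2) ^ 2).
  { apply sqrt_lt_0_alt; rewrite sqrt_pow2 by lra; simpl; now rewrite !Rmult_1_r. }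
  assert (ET : T = p_infty) by exact (near_trajectory_global k T u v Hk Htr H0').
  subst T; split; [reflexivity|].
  destruct (near_trajectory_polar k u v Hk Htr Hnc H0') as [r [theta [H1 H2]]].
  exists r, theta; split; [exact H1 | exact (HP r theta H2)].
Qed.

Theorem corollary5p2 (beta omega : R) (hbeta : 0 < beta) (homega : 0 < omega) :
  critical_point (sqrt_system beta omega) (1 / 2, 0) /\
  (omega < omega_star beta ->
     stable_node (sqrt_system beta omega) (1 / 2, 0)) /\
  (omega > omega_star beta ->
     stable_spiral (sqrt_system beta omega) (1 / 2, 0)) /\
  (omega = omega_star beta ->
     stable_inflected_node (sqrt_system beta omega) (1 / 2, 0)).
Proof.
  change (sqrt_system beta omega) with (damped (beta / sqrt omega)).
  set (k := beta / sqrt omega).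
  assert (Hw : 0 < sqrt omega) by now apply sqrt_lt_R0.
  assert (Hw2 : sqrt omega * sqrt omega = omega) by (apply sqrt_sqrt; lra).
  assert (Hk : 0 < k) by now apply Rdiv_lt_0_compat.
  assert (Ek : k * sqrt omega = beta) by (unfold k; field; lra).
  assert (Ek2 : omega_star beta = k * k / 4 * omega).
  { unfold omega_star; rewrite <- Ek; rewrite <- Hw2 at 2; field. }
  assert (Hnode : 2 <= k -> stable_node (damped k) (1 / 2, 0)).
  { intros H; apply nearby_of_polar_motion; [exact Hk|].
    intros r theta Hsp; split; [apply Hsp|].
    exact (polar_motion_angle_limit k r theta H Hsp). }
  split; [|split; [|split]].
  - repeat split; simpl; [lra|].
    replace (2 * (1 / 2)) with 1 by field; rewrite sqrt_1; ring.
  - intros H; apply Hnode; rewrite Ek2 in H.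
    apply Rnot_lt_le; intros Hlt.
    assert (Hkk : k * k < 2 * 2) by (apply Rmult_le_0_lt_compat; lra).
    assert (0 < (4 - k * k) * omega) by (apply Rmult_lt_0_compat; lra); lra.
  - intros H; rewrite Ek2 in H.
    assert (Hk2 : k < 2).
    { apply Rnot_le_lt; intros Hle.
      assert (Hkk : 2 * 2 <= k * k) by (apply Rmult_le_compat; lra).
      assert (0 <= (k * k - 4) * omega) by (apply Rmult_le_pos; lra); lra. }
    apply nearby_of_polar_motion; [exact Hk|].
    intros r theta Hsp; split; [apply Hsp|].
    exact (polar_motion_angle_unbounded k r theta (conj Hk Hk2) Hsp).
  - intros H; rewrite Ek2 in H.
    assert (Hk2 : k = 2).
    { assert (Hkk : (k * k - 4) * omega = 0) by lra.
      apply Rmult_integral in Hkk; destruct Hkk as [Hkk|]; [nra | lra]. }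
    split; [apply Hnode; lra|].
    exists 1, (-1); split; [intros E; injection E; lra|].
    apply nearby_of_polar_motion; [exact Hk|].
    intros r theta Hsp; split; [apply Hsp|].
    destruct (polar_motion_angle_limit k r theta) as [l Hl]; [lra | exact Hsp |].
    exists l; split; [exact Hl|].
    pose proof (polar_motion_limit_turning k l r theta Hsp Hl) as Ht.
    unfold turning in Ht; rewrite Hk2 in Ht.
    pose proof (sin2_cos2 l) as Hsc; unfold Rsqr in Hsc.
    assert (sin l + cos l = 0); [|lra].
    apply Rsqr_0_uniq; apply Rle_antisym; [unfold Rsqr; lra | apply Rle_0_sqr].
Qed.
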